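(* Let $G$ be a graph with $n$ vertices and let $k$ be the maximum number of allowed swaps. \textsc{Subset Token Swapping} on $G$ can be solved in time $2^{O(n\log n\log k)}=2^{O(n\log^2 n)}$ and space $O(n\log n\log k)=O(n\log^2 n)$.
   Context: \textsc{Subset Token Swapping}: the input is a graph $G=(V,E)$ with one token on each vertex, a function $D$ assigning to each token $t$ a set $D(t)\subseteq V$ of allowed destinations, and an integer $k$. A swap exchanges the tokens on two adjacent vertices. The question is whether at most $k$ swaps suffice to reach a placement in which every token $t$ lies on a vertex of $D(t)$ (instances are assumed to admit some such placement). *)

(* Defs.v *)
From mathcomp Require Import all_boot all_fingroup.

Set Implicit Arguments.
Unset Strict Implicit.
Unset Printing Implicit Defensive.

(* Each token is named after the vertex on which it initially lies, so tokens
   and vertices share the type ['I_n] and the initial placement is the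
   identity. A placement is the permutation sending each token to its current
   vertex. *)
Record instance := Instance {
  nb_vertices : nat;
  edge : rel 'I_nb_vertices;
  edge_sym : symmetric edge;
  edge_irr : irreflexive edge;
  dest : 'I_nb_vertices -> {set 'I_nb_vertices};
  budget : nat;
  dest_admissible : exists p : {perm 'I_nb_vertices}, forall t, p t \in dest t }.

(* [permM] : [(p * tperm u v) t = tperm u v (p t)]. *)
Definition swap n (p : {perm 'I_n}) (uv : 'I_n * 'I_n) : {perm 'I_n} :=
  (p * tperm uv.1 uv.2)%g.

Definition solvable_instance (I : instance) : Prop :=
  exists s : seq ('I_(nb_vertices I) * 'I_(nb_vertices I)),
    [/\ size s <= budget I,
        all (fun uv => edge (i := I) uv.1 uv.2) s
      & forall t, foldl (@swap _) 1%g s t \in dest (i := I) t].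

(* Random access machines under the logarithmic cost criterion: time and space
   are measured in bits. The read-only input is accessed through a random-access
   query instruction and is not counted in the space; only the registers are. *)

(* Length of the binary representation, with length 1 for 0. *)
Definition nbits (x : nat) : nat := (trunc_log 2 x).+1.

Inductive instr :=
| Const of nat & nat          (* Const d a     : R[d] <- a                  *)
| Move of nat & nat           (* Move d x      : R[d] <- R[x]               *)
| Add of nat & nat & nat      (* Add d x y     : R[d] <- R[x] + R[y]        *)
| Sub of nat & nat & nat      (* truncated subtraction                      *)
| Mul of nat & nat & nat
| Div of nat & nat & nat      (* Euclidean quotient, 0 for a zero divisor   *)
| LoadAt of nat & nat         (* LoadAt d x    : R[d] <- R[R[x]]            *)
| StoreAt of nat & nat        (* StoreAt x y   : R[R[x]] <- R[y]            *)
| Read of nat & nat           (* Read d x      : R[d] <- input bit at R[x]  *)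
| Jump of nat
| JumpZ of nat & nat          (* JumpZ x l     : jump to l if R[x] = 0      *)
| Halt of bool.

Definition program := seq instr.

(* Contents of registers 0, 1, ..., m - 1, where m - 1 is the largest index
   written so far; all other registers contain 0. *)
Definition memory := seq nat.

Definition get (R : memory) (i : nat) : nat := nth 0 R i.
Definition put (R : memory) (i x : nat) : memory := set_nth 0 R i x.

(* Unwritten registers below the largest written index are charged one bit
   each, so the contents can be stored consecutively, without addresses. *)
Definition mem_space (R : memory) : nat := \sum_(x <- R) nbits x.

(* A query past the end of the input returns 2. *)
Definition query (w : bitseq) (i : nat) : nat := nth 2 (map nat_of_bool w) i.

(* Multiplication and division are charged for the schoolbook algorithm. *)
Definition cost (R : memory) (ins : instr) : nat :=
  match ins with
  | Const _ a => nbits a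
  | Move _ x => nbits (get R x)
  | Add _ x y | Sub _ x y => nbits (get R x) + nbits (get R y)
  | Mul _ x y | Div _ x y => nbits (get R x) * nbits (get R y)
  | LoadAt _ x => nbits (get R x) + nbits (get R (get R x))
  | StoreAt x y => nbits (get R x) + nbits (get R y)
  | Read _ x => nbits (get R x)
  | JumpZ x _ => nbits (get R x)
  | Jump _ | Halt _ => 1
  end.

Definition exec (w : bitseq) (R : memory) (ins : instr) : memory :=
  match ins with
  | Const d a => put R d a
  | Move d x => put R d (get R x)
  | Add d x y => put R d (get R x + get R y)
  | Sub d x y => put R d (get R x - get R y)
  | Mul d x y => put R d (get R x * get R y)
  | Div d x y => put R d (get R x %/ get R y)
  | LoadAt d x => put R d (get R (get R x))
  | StoreAt x y => put R (get R x) (get R y)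
  | Read d x => put R d (query w (get R x))
  | Jump _ | JumpZ _ _ | Halt _ => R
  end.

Definition next_pc (R : memory) (pc : nat) (ins : instr) : nat :=
  match ins with
  | Jump l => l
  | JumpZ x l => if get R x == 0 then l else pc.+1
  | _ => pc.+1
  end.

(* Leaving the program rejects. *)
Definition fetch (M : program) (pc : nat) : instr := nth (Halt false) M pc.

Definition halting (ins : instr) : option bool :=
  if ins is Halt b then Some b else None.

(* [run M w pc R b t s] : started at instruction [pc] with memory [R], the
   program [M] halts on input [w] with answer [b], after time [t], and [s] is
   the maximum of the space over all memories met on the way. *)
Inductive run (M : program) (w : bitseq) :
    nat -> memory -> bool -> nat -> nat -> Prop :=
| RunHalt pc R b of halting (fetch M pc) = Some b :
    run M w pc R b (cost R (fetch M pc)) (mem_space R)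
| RunStep pc R b t s of halting (fetch M pc) = None
    & run M w (next_pc R pc (fetch M pc)) (exec w R (fetch M pc)) b t s :
    run M w pc R b (cost R (fetch M pc) + t) (maxn (mem_space R) s).

Definition computes (M : program) (w : bitseq) (b : bool) (t s : nat) : Prop :=
  run M w 0 [::] b t s.

(* Least significant bit first, no superfluous leading zeros. *)
Definition binary (x : nat) : bitseq :=
  [seq odd (x %/ 2 ^ i) | i <- iota 0 (nbits x)].

(* The number of vertices in unary, closed by a zero; the adjacency matrix;
   the matrix of the relation [v \in dest t]; the budget in binary. *)
Definition encode (I : instance) : bitseq :=
  nseq (nb_vertices I) true ++ [:: false]
  ++ [seq edge (i := I) u v | u <- enum 'I_(nb_vertices I),
                              v <- enum 'I_(nb_vertices I)]
  ++ [seq v \in dest (i := I) t | t <- enum 'I_(nb_vertices I),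
                                  v <- enum 'I_(nb_vertices I)]
  ++ binary (budget I).

(* [lg x <= log_2 x <= 2 * lg x] for [2 <= x], so the integer part is as good
   as the real logarithm up to constant factors. *)
Notation lg := (trunc_log 2).

(* Main.v *)
(**
Savitch's midpoint recursion on placements. A placement is coded by one number
below [n ^ n]; an extra node [n ^ n], entered from the placements that satisfy
[dest] and never left, turns the question into the existence of a walk of length
[K + 1] from the identity to that node, where a step may also stay in place. The
recursion halves the length, so its stack holds [O(log K)] frames of
[O(n log n)] bits and is itself stored as one number in a large base.

Any placement reachable by swaps is reachable by at most [2 n ^ 2] of them: it
preserves the connected components, hence is a product of at most [n]
transpositions inside components, each a product of at most [2 n] swaps along a
path. So [K] is the budget truncated at [O(n ^ 2)], which can be found without
reading more than [O(log n)] bits of the budget.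

The time bound follows from the space bound, because a halting deterministic run
never repeats a configuration. The machine code is compiled from while programs
whose expressions have values polynomial in their variables; hence only the
values of the finitely many program variables have to be bounded.
*)
Require Import Defs.
From mathcomp Require Import all_boot all_fingroup.
From mathcomp Require Import zify.

Set Implicit Arguments.
Unset Strict Implicit.
Unset Printing Implicit Defensive.

(** * Time from space *)

Lemma nbits_leS x : nbits x <= x.+1.
Proof.
rewrite /nbits ltnS; case: x => [|x]; first by rewrite trunc_log0.
by apply: leq_trans (ltnW (ltn_expl _ _)) (trunc_logP _ _).
Qed.

Lemma leq_nbits x y : x <= y -> nbits x <= nbits y.
Proof. by move=> lexy; rewrite /nbits ltnS leq_trunc_log. Qed.

Lemma nbits_exp2 L : nbits (2 ^ L) = L.+1.
Proof. by rewrite /nbits trunc_expnK. Qed.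

Lemma ltn_nbits x : x < 2 ^ nbits x.
Proof. exact: trunc_log_ltn. Qed.

Definition within r V (R : memory) := size R <= r /\ forall i, get R i <= V.

Lemma within_put r V R d v :
  within r V R -> d < r -> v <= V -> within r V (put R d v).
Proof.
move=> [szR leR] ltd lev; split; first by rewrite size_set_nth geq_max ltd.
by move=> i; rewrite /get /put nth_set_nth /=; case: eqP => // _; apply: leR.
Qed.

Lemma mem_space_within r V R : within r V R -> mem_space R <= r * nbits V.
Proof.
move=> [szR leR]; apply: (@leq_trans (size R * nbits V)); last exact: leq_mul.
rewrite /mem_space -sum1_size big_distrl /= [X in X <= _]big_seq [X in _ <= X]big_seq.
apply: leq_sum => x xR; rewrite mul1n; apply: leq_nbits.
by rewrite -(nth_index 0 xR); apply: leR.
Qed.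

Definition config := (nat * memory)%type.

Section Runs.
Variables (M : program) (w : bitseq) (r V : nat).

Definition nextc (c : config) : config :=
  (next_pc c.2 c.1 (fetch M c.1), exec w c.2 (fetch M c.1)).

Definition live (c : config) :=
  halting (fetch M c.1) = None /\ within r V c.2.

(** Only the configurations strictly before the end must be live, so that segments compose and the
    last configuration may be a halting one. *)
Definition leads (c c' : config) :=
  exists2 N, iter N nextc c = c' & forall j, j < N -> live (iter j nextc c).

Lemma leads_refl c : leads c c.
Proof. by exists 0. Qed.

Lemma leads_step c : live c -> leads c (nextc c).
Proof. by move=> lc; exists 1 => // -[]. Qed.

Lemma leads_trans c1 c2 c3 : leads c1 c2 -> leads c2 c3 -> leads c1 c3.
Proof.
move=> [N1 <- l1] [N2 <- l2]; exists (N2 + N1); first by rewrite iterD.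
move=> j ltj; case: (ltnP j N1) => [/l1 //|leNj].
by rewrite -(subnK leNj) iterD; apply: l2; rewrite ltn_subLR // addnC.
Qed.

(* A halting deterministic run repeats no configuration, so its length is
   bounded by the number of configurations. *)
Lemma halting_run_length c N :
  halting (fetch M (iter N nextc c).1) <> None ->
  (forall j, j < N -> live (iter j nextc c)) ->
  N <= (size M).+1 * V.+2 ^ r.
Proof.
move=> haltN liveN.
have distinct i j : i < j -> j < N -> iter i nextc c <> iter j nextc c.
  (* A repetition at times [i < j] identifies the configuration at time [N] with the one at time
     [N - j + i], which is live and so cannot halt. *)
  move=> ltij ltjN eq_ij; case: haltN.
  have -> : iter N nextc c = iter (N - j + i) nextc c.
    by rewrite iterD eq_ij -iterD subnK // ltnW.
  by apply: (liveN _ _).1; lia.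
(* The default [V.+1] exceeds every register, so the [r] values read also reveal the length of the
   memory. A live program counter lies inside the program, because [fetch] halts elsewhere, so
   [inord] loses nothing. *)
pose f (j : 'I_N) : 'I_(size M).+1 * {ffun 'I_r -> 'I_V.+2} :=
  (inord (iter j nextc c).1,
   [ffun i : 'I_r => inord (nth V.+1 (iter j nextc c).2 i)]).
have eq_f j1 j2 : f j1 = f j2 -> iter j1 nextc c = iter j2 nextc c.
  move: (liveN _ (ltn_ord j1)) (liveN _ (ltn_ord j2)); rewrite /f.
  case: (iter j1 nextc c) (iter j2 nextc c) => [pc1 R1] [pc2 R2] /=.
  have pc_le pc : halting (fetch M pc) = None -> pc < (size M).+1.
    by rewrite ltnS; case: (ltnP pc (size M)) => [/ltnW|le] //;
      rewrite /fetch nth_default.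
  have nth_lt R i : within r V R -> nth V.+1 R i < V.+2.
    move=> [_ leR]; case: (ltnP i (size R)) => lti; last by rewrite nth_default.
    by rewrite (set_nth_default 0) // ltnS ltnW // ltnS; apply: leR.
  move=> [/pc_le lt1 win1] [/pc_le lt2 win2] [].
  move/(congr1 val); rewrite /= !inordK // => -> /ffunP eqR.
  congr pair.
  have eqn i : i < r -> nth V.+1 R1 i = nth V.+1 R2 i.
    move=> lti; have /(congr1 val) := eqR (Ordinal lti).
    by rewrite !ffunE /= !inordK //; apply: nth_lt.
  have szle Ra Rb : within r V Ra -> within r V Rb ->
      (forall i, i < r -> nth V.+1 Ra i = nth V.+1 Rb i) -> size Rb <= size Ra.
    move=> wina [szb leb] eqab; case: (leqP (size Rb) (size Ra)) => // ltab.
    have := eqab _ (leq_trans ltab szb); rewrite nth_default // => eqV.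
    by have := leb (size Ra); rewrite /get (set_nth_default V.+1) // -eqV ltnn.
  apply: (@eq_from_nth _ V.+1).
    by apply/eqP; rewrite eqn_leq !szle // => i /eqn.
  by move=> i lti; apply: eqn; apply: leq_trans lti win1.1.
have inj_f : injective f.
  move=> j1 j2 /eq_f eqj; apply: val_inj => /=.
  by case: (ltngtP j1 j2) => // /distinct /(_ (ltn_ord _)) [].
have := leq_card f inj_f.
by rewrite card_prod card_ffun !card_ord.
Qed.

(** The factor is [N.+1] because the final halting instruction is charged as well. *)
Lemma run_of_leads C N pc R b :
    (forall pc R, within r V R -> cost R (fetch M pc) <= C) ->
    halting (fetch M (iter N nextc (pc, R)).1) = Some b ->
    within r V (iter N nextc (pc, R)).2 ->
    (forall j, j < N -> live (iter j nextc (pc, R))) ->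
  exists t s, [/\ run M w pc R b t s, t <= N.+1 * C & s <= r * nbits V].
Proof.
move=> costC; elim: N pc R => [|N IHN] pc R.
  move=> /= haltR winR _; exists (cost R (fetch M pc)), (mem_space R).
  by split; [exact: RunHalt | rewrite mul1n costC | exact: mem_space_within].
rewrite !iterSr => haltN winN liveN.
have [haltR winR] : live (pc, R) := liveN 0 isT.
have [j ltj|t [s [runt let_ les]]] := IHN _ _ haltN winN.
  by have := liveN j.+1; rewrite iterSr; apply.
exists (cost R (fetch M pc) + t), (maxn (mem_space R) s); split.
- exact: RunStep.
- by rewrite mulSn leq_add // costC.
- by rewrite geq_max les mem_space_within.
Qed.

End Runs.

(** [Const] is the only instruction charged for a literal of the program instead of the contents of
    the memory. *)
Lemma fetch_const_bounded (M : program) :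
  exists C, forall pc d a, fetch M pc = Const d a -> nbits a <= C.
Proof.
elim: M => [|i M [C leC]]; first by exists 0 => pc d a; rewrite /fetch nth_nil.
case: (i) => [d0 a0|||||||||||]; [exists (C + nbits a0) | by exists C; case..].
move=> [|pc] d a /=; first by rewrite /fetch /= => -[_ <-]; rewrite leq_addl.
by move/leC/leq_trans; apply; rewrite leq_addr.
Qed.

(** Bit lengths are bounded crudely by [V.+1], since the time bound is exponential anyway; the
    square comes from multiplication and division. *)
Lemma cost_bounded (M : program) :
  exists C, forall r V R pc,
    within r V R -> cost R (fetch M pc) <= C + 3 * V.+1 ^ 2.
Proof.
have [C leC] := fetch_const_bounded M.
exists C => r V R pc [_ leR].
have leb x : nbits (get R x) <= V.+1.
  by apply: leq_trans (nbits_leS _) _; rewrite ltnS.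
have := leC pc; case: (fetch M pc) => /=.
- by move=> d a /(_ _ _ erefl); lia.
- by move=> _ x _; have := leb x; nia.
- by move=> _ x y _; have := leb x; have := leb y; nia.
- by move=> _ x y _; have := leb x; have := leb y; nia.
- by move=> _ x y _; have := leq_mul (leb x) (leb y); lia.
- by move=> _ x y _; have := leq_mul (leb x) (leb y); lia.
- by move=> _ x _; have := leb x; have := leb (get R x); nia.
- by move=> x y _; have := leb x; have := leb y; nia.
- by move=> _ x _; have := leb x; nia.
- by move=> _ _; nia.
- by move=> x _ _; have := leb x; nia.
- by move=> _ _; nia.
Qed.

(** For a fixed program and fixed [r], the number of configurations and the cost of a step are both
    polynomial in [2 ^ L], so their product is at most [2 ^ (c * L)]. *)
Lemma within_computes (M : program) r :
  exists c, forall w L b c', 0 < L ->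
    leads M w r (2 ^ L) (0, [::]) c' -> within r (2 ^ L) c'.2 ->
    halting (fetch M c'.1) = Some b ->
  exists t s, [/\ computes M w b t s, t <= 2 ^ (c * L) & s <= c * L].
Proof.
have [C leC] := cost_bounded M.
(* The first three summands pay for the number of instructions, [C + 3 + 4] for the cost of each,
   and the last [2 * r] for the space [r * L.+1]. *)
exists ((size M).+1 + 2 * r + 1 + (C + 3 + 4) + 2 * r) => w L b c' L0.
move=> [N <- liveN] winN haltN.
have lenN : N <= (size M).+1 * (2 ^ L).+2 ^ r.
  by apply: (@halting_run_length M w r (2 ^ L) (0, [::])); rewrite ?haltN.
have [|t [s [runt let_ les]]] :=
  @run_of_leads M w r (2 ^ L) (C + 3 * (2 ^ L).+1 ^ 2) N 0 [::] b _ haltN winN liveN.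
  by move=> pc R; apply: leC.
exists t, s; split=> //.
- apply: leq_trans let_ _.
  have two_pow x : x <= 2 ^ (x * L).
    apply: leq_trans (ltnW (ltn_expl x (isT : 1 < 2))) _.
    by rewrite leq_exp2l // leq_pmulr.
  have X2 : 2 <= 2 ^ L by rewrite -{1}(expn1 2) leq_exp2l.
  have XX : (2 ^ L).+2 <= 2 ^ (2 * L) by rewrite mulnC expnM; nia.
  have -> : ((size M).+1 + 2 * r + 1 + (C + 3 + 4) + 2 * r) * L
      = ((size M).+1 * L + (2 * L) * r + L) + ((C + 3) * L + (2 * L) * 2) + 2 * r * L.
    by lia.
  apply: leq_trans (leq_pexp2l _ (leq_addr _ _)) => //.
  rewrite expnD; apply: leq_mul.
    apply: (@leq_trans (2 ^ ((size M).+1 * L + 2 * L * r)).+1).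
      rewrite ltnS expnD; apply: leq_trans lenN _; apply: leq_mul (two_pow _) _.
      by rewrite [X in _ <= X]expnM; case: (posnP r) => [->|r0] //; rewrite leq_exp2r.
    rewrite [X in _ <= X]expnD; move: (2 ^ (_ + 2 * L * r)) (expn_gt0 2 ((size
      M).+1 * L + 2 * L * r)) => Y /= Y0; nia.
  rewrite expnD; apply: (@leq_trans ((C + 3) * (2 ^ (2 * L)) ^ 2)).
    have : (2 ^ L).+1 ^ 2 <= (2 ^ (2 * L)) ^ 2 by rewrite leq_sqr ltnW.
    have : 0 < (2 ^ (2 * L)) ^ 2 by rewrite !expn_gt0.
    by move: (_.+1 ^ 2) (_ ^ 2) => X Y; nia.
  by rewrite -expnM leq_mul2r two_pow orbT.
- apply: leq_trans les _; rewrite nbits_exp2; nia.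
Qed.

(** * Expressions *)

Definition upd (f : nat -> nat) x v := fun y => if y == x then v else f y.

Inductive op := OAdd | OSub | OMul | ODiv.

Inductive expr :=
| Var of nat
| Cst of nat
| Bin of op & expr & expr
| Query of expr
| Iter of nat & nat & expr & expr & expr.

Definition opval (o : op) : nat -> nat -> nat :=
  match o with OAdd => addn | OSub => subn | OMul => muln | ODiv => divn end.

Definition opinstr (o : op) : nat -> nat -> nat -> instr :=
  match o with OAdd => Add | OSub => Defs.Sub | OMul => Mul | ODiv => Div end.

(* [Iter i a n e0 e]: limited recursion on the accumulator [a] with the index
   [i] running from 0 to [n - 1]. Capping at the initial value makes the values
   of an expression polynomial in those of its variables. *)
Fixpoint eval (w : bitseq) (f : nat -> nat) (e : expr) : nat :=
  match e with
  | Var x => f x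
  | Cst c => c
  | Bin o e1 e2 => opval o (eval w f e1) (eval w f e2)
  | Query e1 => query w (eval w f e1)
  | Iter i a n e0 e1 =>
      let m := eval w f e0 in
      iteri (eval w f n) (fun j y => minn (eval w (upd (upd f i j) a y) e1) m) m
  end.

Fixpoint wfe nv (e : expr) : bool :=
  match e with
  | Var x => x < nv
  | Cst _ => true
  | Bin _ e1 e2 => wfe nv e1 && wfe nv e2
  | Query e1 => wfe nv e1
  | Iter i a n e0 e1 =>
      [&& i < nv, a < nv, i != a, wfe nv n, wfe nv e0 & wfe nv e1]
  end.

(** An exponent for intermediate values as well as for the result. The body of [Iter] sees an index
    and an accumulator of degree up to [deg n + deg e0], hence the product. *)
Fixpoint deg (e : expr) : nat :=
  match e with
  | Var _ => 1
  | Cst c => c.+1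
  | Bin _ e1 e2 => deg e1 + deg e2
  | Query e1 => (deg e1).+1
  | Iter _ _ n e0 e1 => (deg n + deg e0) * (deg e1).+1
  end.

(** The six registers added for [Iter] hold the count, the cap, the saved contents of the two loop
    variables, the value of the body and a scratch value. *)
Fixpoint temps (e : expr) : nat :=
  match e with
  | Var _ | Cst _ => 1
  | Bin _ e1 e2 => (temps e1 + temps e2).+1
  | Query e1 => temps e1
  | Iter _ _ n e0 e1 => temps n + temps e0 + temps e1 + 6
  end.

Lemma deg_gt0 e : 0 < deg e.
Proof. by elim: e => //= *; nia. Qed.

Lemma temps_gt0 e : 0 < temps e.
Proof. by elim: e => //= *; lia. Qed.

Lemma eval_ext w nv e f g :
  wfe nv e -> (forall x, x < nv -> f x = g x) -> eval w f e = eval w g e.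
Proof.
elim: e f g => //=.
- by move=> x f g ltx; apply.
- by move=> o e1 IH1 e2 IH2 f g /andP[w1 w2] eqfg; rewrite (IH1 f g) ?(IH2 f g).
- by move=> e1 IH1 f g w1 eqfg; rewrite (IH1 f g).
- move=> i a n IHn e0 IH0 e1 IH1 f g /and5P[_ _ _ wn /andP[w0 w1]] eqfg.
  rewrite (IHn f g) ?(IH0 f g) //; apply: eq_iteri => j y; congr minn.
  by apply: IH1 => // x ltx; rewrite /upd; do 2 case: ifP => // _; apply: eqfg.
Qed.

Lemma query_le2 w i : query w i <= 2.
Proof.
by rewrite /query; elim: w i => [|[] w IHw] [|i] //=.
Qed.

Lemma iteri_min_le n (F : nat -> nat -> nat) m :
  iteri n (fun j y => minn (F j y) m) m <= m.
Proof. by case: n => //= n; rewrite geq_minr. Qed.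

Lemma leq_expr M d : 0 < M -> 0 < d -> M <= M ^ d.
Proof. by case: d => // d M0 _; rewrite expnS leq_pmulr // expn_gt0 M0. Qed.

(** All bounds [M ^ deg e] are at least 2, so a sum is dominated by the product of the bounds and
    degrees add up for every operation. The cap keeps the value of [Iter] at most that of [e0]. *)
Lemma eval_le w nv e f M : 1 < M ->
  wfe nv e -> (forall x, x < nv -> f x <= M) -> eval w f e <= M ^ deg e.
Proof.
move=> M2; have M0 : 0 < M by apply: ltnW.
have two_le e' : 2 <= M ^ deg e'.
  by apply: leq_trans M2 (leq_expr M0 (deg_gt0 _)).
elim: e f => //=.
- by move=> x f ltx; rewrite expn1; apply.
- move=> c f _ _; apply: leq_trans (ltnW (ltn_expl c M2)) _.
  by rewrite leq_exp2l.
- move=> o e1 IH1 e2 IH2 f /andP[w1 w2] lef; rewrite expnD.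
  have := IH1 f w1 lef; have := IH2 f w2 lef.
  have := two_le e1; have := two_le e2.
  case: o => /=; [nia | nia | by move=> *; apply: leq_mul |].
  by move=> *; apply: leq_trans (leq_div _ _) _; nia.
- move=> e1 IH1 f w1 lef; apply: leq_trans (query_le2 _ _) _.
  by apply: leq_trans M2 _; apply: leq_expr.
- move=> i a n IHn e0 IH0 e1 IH1 f /and5P[_ _ _ wn /andP[w0 w1]] lef.
  apply: leq_trans (iteri_min_le _ _ _) _; apply: leq_trans (IH0 _ w0 lef) _.
  by rewrite leq_exp2l //; have := deg_gt0 e1; nia.
Qed.

(* [cexp a t e]: code placed at address [a] that leaves the value of [e] in
   register [t] and uses no register below [t] except, temporarily, the two
   variables of each [Iter]. *)
Fixpoint cexp (a t : nat) (e : expr) : program :=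
  match e with
  | Var x => [:: Move t x]
  | Cst c => [:: Const t c]
  | Bin o e1 e2 =>
      let c1 := cexp a t e1 in
      let c2 := cexp (a + size c1) t.+1 e2 in
      c1 ++ c2 ++ [:: opinstr o t t t.+1]
  | Query e1 => cexp a t e1 ++ [:: Read t t]
  | Iter i y n e0 e1 =>
      let c1 := cexp a t n in
      let c2 := cexp (a + size c1) t.+1 e0 in
      let loop := (a + size c1 + size c2).+4 in
      let c3 := cexp loop.+2 (t + 4) e1 in
      let stop := (loop.+2 + size c3).+4.+1 in
      c1 ++ c2 ++
      [:: Move (t + 2) i; Move (t + 3) y; Const i 0; Move y t.+1;
          (* loop *)
          Defs.Sub (t + 4) t i; JumpZ (t + 4) stop] ++
      c3 ++
      [:: Defs.Sub (t + 5) (t + 4) t.+1; Defs.Sub y (t + 4) (t + 5);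
          Const (t + 4) 1; Add i i (t + 4); Jump loop;
          (* stop *)
          Move t y; Move i (t + 2); Move y (t + 3)]
  end.

Definition code_at (M : program) a (c : program) :=
  forall j, j < size c -> fetch M (a + j) = fetch c j.

Lemma code_at_cat M a c1 c2 :
  code_at M a (c1 ++ c2) -> code_at M a c1 /\ code_at M (a + size c1) c2.
Proof.
move=> cat; split=> j ltj.
  by rewrite cat ?size_cat ?ltn_addr // /fetch nth_cat ltj.
rewrite -addnA cat ?size_cat ?ltn_add2l // /fetch nth_cat ltnNge leq_addr /=.
by rewrite addKn.
Qed.

Lemma code_at_cons M a i c :
  code_at M a (i :: c) -> fetch M a = i /\ code_at M a.+1 c.
Proof.
move=> cat; split; first by rewrite -[a]addn0 cat.
by move=> j ltj; rewrite addSnnS cat.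
Qed.

(** * Correctness of compiled expressions *)

Section Compile.
Variables (M : program) (w : bitseq) (r V : nat).

(** Register contents are compared as functions, so that memories differing only by trailing zeros
    are not distinguished. *)
Definition reaches pc (f : nat -> nat) pc' (f' : nat -> nat) :=
  forall R, within r V R -> get R =1 f ->
  exists R', [/\ leads M w r V (pc, R) (pc', R'), within r V R' & get R' =1 f'].

Lemma reaches_refl pc f : reaches pc f pc f.
Proof. by move=> R winR eqR; exists R; split=> //; apply: leads_refl. Qed.

Lemma reaches_trans pc1 f1 pc2 f2 pc3 f3 :
  reaches pc1 f1 pc2 f2 -> reaches pc2 f2 pc3 f3 -> reaches pc1 f1 pc3 f3.
Proof.
move=> r12 r23 R1 win1 /(r12 _ win1)[R2 [l12 win2 /(r23 _ win2)[R3 [l23 win3 eq3]]]].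
by exists R3; split=> //; apply: leads_trans l12 l23.
Qed.

Lemma get_put R d v x : get (put R d v) x = upd (get R) d v x.
Proof. by rewrite /get /put nth_set_nth. Qed.

Lemma reaches_put pc f d v :
  d < r -> v <= V -> halting (fetch M pc) = None ->
  (forall R, get R =1 f ->
     nextc M w (pc, R) = (pc.+1, put R d v)) ->
  reaches pc f pc.+1 (upd f d v).
Proof.
move=> ltd lev nh step R winR eqR; exists (put R d v); split.
- by rewrite -step //; apply: leads_step.
- exact: within_put.
- by move=> x; rewrite get_put /upd eqR.
Qed.

Lemma reaches_const pc f d c :
  fetch M pc = Const d c -> d < r -> c <= V -> reaches pc f pc.+1 (upd f d c).
Proof.
move=> fM ltd lec; apply: reaches_put => //; first by rewrite fM.
by move=> R eqR; rewrite /nextc /= fM.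
Qed.

Lemma reaches_move pc f d x :
  fetch M pc = Move d x -> d < r -> f x <= V -> reaches pc f pc.+1 (upd f d (f x)).
Proof.
move=> fM ltd lec; apply: reaches_put => //; first by rewrite fM.
by move=> R eqR; rewrite /nextc /= fM /= eqR.
Qed.

Lemma reaches_op pc f o d x y :
  fetch M pc = opinstr o d x y -> d < r -> opval o (f x) (f y) <= V ->
  reaches pc f pc.+1 (upd f d (opval o (f x) (f y))).
Proof.
move=> fM ltd lec; apply: reaches_put => //; first by rewrite fM; case: (o).
by move=> R eqR; rewrite /nextc /= fM; case: (o) => /=; rewrite !eqR.
Qed.

Lemma reaches_read pc f d x :
  fetch M pc = Read d x -> d < r -> 1 < V ->
  reaches pc f pc.+1 (upd f d (query w (f x))).
Proof.
move=> fM ltd V2; apply: reaches_put => //.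
- exact: leq_trans (query_le2 _ _) V2.
- by rewrite fM.
- by move=> R eqR; rewrite /nextc /= fM /= eqR.
Qed.

Lemma reaches_jump pc f l : fetch M pc = Jump l -> reaches pc f l f.
Proof.
move=> fM R winR eqR; exists R; split=> //.
have -> : (l, R) = nextc M w (pc, R) by rewrite /nextc /= fM.
by apply: leads_step; split; rewrite ?fM.
Qed.

Lemma reaches_jumpz pc f x l :
  fetch M pc = JumpZ x l -> reaches pc f (if f x == 0 then l else pc.+1) f.
Proof.
move=> fM R winR eqR; exists R; split=> //; rewrite -eqR.
have -> : ((if get R x == 0 then l else pc.+1), R) = nextc M w (pc, R).
  by rewrite /nextc /= fM.
by apply: leads_step; split; rewrite ?fM.
Qed.

Variable nv : nat.

Local Ltac updsimp := rewrite /upd; repeat (case: eqP => //=; try lia).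

(** [B] bounds the program variables and [V] all registers. The induction generalizes [B] because
    the body of an [Iter] runs under the larger bound [B ^ D], with [D] the sum of the degrees of
    the count and of the initial value. *)
Lemma cexp_reaches e B a t f : 1 < B -> wfe nv e ->
  code_at M a (cexp a t e) -> nv <= t -> t + temps e <= r -> B ^ deg e <= V ->
  (forall x, x < nv -> f x <= B) -> (forall x, x < t -> f x <= V) ->
  exists f', [/\ reaches a f (a + size (cexp a t e)) f',
    forall x, x < t -> f' x = f x & f' t = eval w f e].
Proof.
elim: e B a t f.
- move=> x B a t f B2 /= ltx cat let_ ler leV leB leV'.
  have [fM _] := code_at_cons cat.
  exists (upd f t (f x)); split.
  + by rewrite addn1; apply: reaches_move => //; [lia | apply: leV'; lia].
  + by move=> y lty; updsimp.
  + by rewrite /upd eqxx.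
- move=> c B a t f B2 /= _ cat let_ ler leV leB leV'.
  have [fM _] := code_at_cons cat.
  exists (upd f t c); split.
  + rewrite addn1; apply: reaches_const => //; first lia.
    apply: leq_trans leV; apply: leq_trans (ltnW (ltn_expl c B2)) _.
    by rewrite leq_exp2l.
  + by move=> y lty; updsimp.
  + by rewrite /upd eqxx.
- move=> o e1 IH1 e2 IH2 B a t f B2 wf cat let_ ler leV leB leV'.
  have evV := leq_trans (eval_le w B2 wf leB) leV.
  move: wf cat ler leV evV => /= /andP[w1 w2] /code_at_cat[cat1].
  move=> /code_at_cat[cat2 /code_at_cons[fM _]] ler leV evV.
  have dV e' : deg e' <= deg e1 + deg e2 -> B ^ deg e' <= V.
    by move=> led; apply: leq_trans leV; rewrite leq_exp2l.
  have [||f1 [r1 s1 v1]] := IH1 B a t f B2 w1 cat1 let_ _ _ leB leV'.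
    by lia. by apply: dV; apply: leq_addr.
  have [|||x ltx|x ltx|f2 [r2 s2 v2]] := IH2 B _ t.+1 f1 B2 w2 cat2.
  + by lia. + by lia. + by apply: dV; apply: leq_addl.
  + by rewrite s1; [apply: leB | lia].
  + case: (ltngtP x t) => [ltxt||->]; [by rewrite s1 // leV' | by lia|].
    by rewrite v1; apply: leq_trans (eval_le w B2 w1 leB) (dV _ (leq_addr _ _)).
  have e2f : eval w f1 e2 = eval w f e2.
    by apply: eval_ext w2 _ => x ltx; apply: s1; lia.
  have v2t : f2 t = eval w f e1 by rewrite s2 // v1.
  exists (upd f2 t (opval o (f2 t) (f2 t.+1))); split.
  + apply: reaches_trans r1 (reaches_trans r2 _).
    rewrite !size_cat /= addn1 !addnS addnA; apply: reaches_op => //; first lia.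
    by rewrite v2t v2 e2f.
  + by move=> x ltx; rewrite /upd ltn_eqF // s2 ?s1 //; lia.
  + by rewrite /upd eqxx v2t v2 e2f.
- move=> e1 IH1 B a t f B2 /= w1 /code_at_cat[cat1 /code_at_cons[fM _]].
  move=> let_ ler leV leB leV'.
  have [|f1 [r1 s1 v1]] := IH1 B a t f B2 w1 cat1 let_ ler _ leB leV'.
    by apply: leq_trans leV; rewrite leq_exp2l.
  exists (upd f1 t (query w (f1 t))); split.
  + apply: reaches_trans r1 _; rewrite size_cat /= addn1 addnS.
    apply: reaches_read => //; first by have := temps_gt0 e1; lia.
    apply: leq_trans leV; apply: (leq_trans B2); apply: leq_expr => //; exact: ltnW.
  + by move=> x ltx; rewrite /upd ltn_eqF // s1.
  + by rewrite /upd eqxx v1.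
- move=> i y n IHn e0 IH0 e1 IH1 B a t f B2 wf cat let_ ler leV leB leV'.
  have evV := leq_trans (eval_le w B2 wf leB) leV.
  move: wf cat ler leV evV => /= /and5P[lti lty /eqP neiy wn /andP[w0 w1]].
  move=> /code_at_cat[cat1] /code_at_cat[cat2] /code_at_cons[fM1].
  move=> /code_at_cons[fM2] /code_at_cons[fM3] /code_at_cons[fM4].
  move=> /code_at_cons[fM5] /code_at_cons[fM6] /code_at_cat[cat3].
  move=> /code_at_cons[fM7] /code_at_cons[fM8] /code_at_cons[fM9].
  move=> /code_at_cons[fM10] /code_at_cons[fM11] /code_at_cons[fM12].
  move=> /code_at_cons[fM13] /code_at_cons[fM14 _].
  set (a1 := a + size (cexp a t n)) in *.
  set (c2 := cexp a1 t.+1 e0) in *.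
  set (a2 := a1 + size c2) in *.
  set (c3 := cexp a2.+4.+2 (t + 4) e1) in *.
  set (a3 := a2.+4.+2 + size c3) in *.
  set D := deg n + deg e0; move=> ler leV evV.
  have D0 : 0 < D by have := deg_gt0 n; rewrite /D; lia.
  have leBD : B <= B ^ D by apply: leq_expr => //; apply: ltnW.
  have dV d : d <= D * (deg e1).+1 -> B ^ d <= V.
    by move=> led; apply: leq_trans leV; rewrite leq_exp2l.
  have BDV : B ^ D <= V by apply: dV; rewrite leq_pmulr.
  have V1 : 1 <= V by lia.
  set N := eval w f n; set m := eval w f e0.
  have leN : N <= B ^ D.
    by apply: leq_trans (eval_le w B2 wn leB) _; rewrite leq_exp2l // leq_addr.
  have lem : m <= B ^ D.
    by apply: leq_trans (eval_le w B2 w0 leB) _; rewrite leq_exp2l // leq_addl.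
  have [||f1 [r1 s1 v1]] := IHn B a t f B2 wn cat1 let_ _ _ leB leV'.
    by lia. by apply: dV; rewrite mulnS; apply: leq_trans (leq_addr _ _) (leq_addr _ _).
  have [|||x ltx|x ltx|f2 [r2 s2 v2]] := IH0 B _ t.+1 f1 B2 w0 cat2.
    by lia. by lia.
    by apply: dV; rewrite mulnS; apply: leq_trans (leq_addl _ _) (leq_addr _ _).
    by rewrite s1; [apply: leB | lia].
    case: (ltngtP x t) => [ltxt||->]; [by rewrite s1 // leV' | by lia|].
    by rewrite v1 -/N; lia.
  have e2f : eval w f1 e0 = m by apply: eval_ext w0 _ => x ltx; apply: s1; lia.
  have f2t : f2 t = N by rewrite s2 // v1.
  have f2x x : x < t -> f2 x = f x by move=> ltx; rewrite s2 ?s1 //; lia.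
  rewrite {}e2f in v2.
  pose F j z := minn (eval w (upd (upd f i j) y z) e1) m.
  have accm j : iteri j F m <= m by apply: iteri_min_le.
  (* Loop invariant: [t] and [t.+1] keep the count and the cap, [t + 2] and [t + 3] the saved
     contents of the loop variables, while [i] and [y] hold the index and the accumulator. *)
  pose inv j g := [/\ forall x, x < t -> x <> i -> x <> y -> g x = f x,
    g i = j, g y = iteri j F m, g t = N &
    [/\ g t.+1 = m, g (t + 2) = f i & g (t + 3) = f y]].
  have fiV : f i <= V by apply: leV'; lia.
  have fyV : f y <= V by apply: leV'; lia.
  have [f6 r6 inv6] : exists2 f6, reaches a2 f2 a2.+4 f6 & inv 0 f6.
    pose f3 := upd f2 (t + 2) (f2 i); pose f4 := upd f3 (t + 3) (f3 y).
    pose f5 := upd f4 i 0; pose f6 := upd f5 y (f5 t.+1).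
    have f3y : f3 y = f y by rewrite /f3 -(f2x y); [updsimp | lia].
    have f5t : f5 t.+1 = m by rewrite /f5 /f4 /f3; updsimp.
    exists f6.
      apply: reaches_trans; first by apply: (reaches_move fM1);
        [lia | rewrite f2x //; lia].
      rewrite -/f3; apply: reaches_trans; first by apply: (reaches_move fM2);
        [lia | rewrite f3y].
      rewrite -/f4; apply: reaches_trans; first by apply: (reaches_const fM3); lia.
      by rewrite -/f5; apply: (reaches_move fM4); [lia | rewrite f5t; lia].
    split; last split.
    + by move=> x ltx nei ney; rewrite /f6 /f5 /f4 /f3 -(f2x x) //; updsimp.
    + by rewrite /f6 /f5; updsimp.
    + by rewrite /f6 {1}/upd eqxx f5t.
    + by rewrite /f6 /f5 /f4 /f3; updsimp.
    + by rewrite /f6 f5t; updsimp.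
    + by rewrite /f6 /f5 /f4 /f3 -(f2x i); [updsimp | lia].
    + by rewrite /f6 /f5 /f4 -f3y; updsimp.
  have loop k j g : k = N - j -> j <= N -> inv j g ->
      exists2 g', reaches a2.+4 g a3.+4.+1 g' & inv N g'.
    elim: k j g => [|k IHk] j g eqk lej [gx gi gy gt [gt1 gt2 gt3]].
      exists (upd g (t + 4) (N - j)).
        apply: reaches_trans.
          by apply: (reaches_op (o := OSub) fM5); rewrite /= ?gt ?gi; lia.
        rewrite /= gt gi; have := @reaches_jumpz _ (upd g (t + 4) (N - j)) _ _ fM6.
        by have -> : upd g (t + 4) (N - j) (t + 4) = 0 by rewrite /upd eqxx.
      have -> : N = j by lia.
      by split; last split; [move=> x ltx nei ney; rewrite -gx //| | | | | |]; updsimp.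
    pose ga := upd g (t + 4) (N - j).
    have gax x : x < t + 4 -> ga x = g x by move=> ltx; rewrite /ga; updsimp.
    have gaB x : x < nv -> ga x <= B ^ D.
      move=> ltx; rewrite gax; last lia.
      have [->|/eqP nei] := eqVneq x i; first by rewrite gi; lia.
      have [->|/eqP ney] := eqVneq x y; first by rewrite gy; have := accm j; lia.
      by rewrite gx //; [apply: leq_trans (leB _ ltx) leBD | lia].
    have BD2 : 1 < B ^ D by lia.
    (* The body reads only variables below [nv], where the invariant makes [ga] agree with the
       environment prescribed by [eval]. *)
    have ev3 : eval w ga e1 = eval w (upd (upd f i j) y (iteri j F m)) e1.
      apply: eval_ext w1 _ => x ltx; rewrite gax; last lia.
      rewrite /upd; have [->//|/eqP ney] := eqVneq x y.
      by have [->//|/eqP nei] := eqVneq x i; rewrite gx //; lia.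
    have [|||x ltx|gb [r3 s3 v3]] := IH1 (B ^ D) a2.+4.+2 (t + 4) ga BD2 w1 cat3 _
      _ _ gaB.
      by lia. by lia. by rewrite -expnM; apply: dV; rewrite mulnS leq_addl.
      rewrite gax //; have [->|/eqP nei] := eqVneq x i; first by rewrite gi; lia.
      have [->|/eqP ney] := eqVneq x y; first by rewrite gy; have := accm j; lia.
      have : x < t \/ x = t \/ x = t.+1 \/ x = t + 2 \/ x = t + 3 by lia.
      case=> [ltxt|[->|[->|[->|->]]]]; rewrite ?gt ?gt1 ?gt2 ?gt3 //; try lia.
      by rewrite gx // leV'.
    rewrite ev3 in v3; set v := eval w _ e1 in v3.
    have vV : v <= V.
      rewrite /v -ev3; apply: leq_trans (eval_le w BD2 w1 gaB) _.
      by rewrite -expnM; apply: dV; rewrite mulnS leq_addl.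
    (* With truncated subtraction, [v - (v - m)] is the minimum of [v] and [m]. *)
    pose g1 := upd gb (t + 5) (v - m).
    pose g2 := upd g1 y (v - (v - m)).
    pose g3 := upd g2 (t + 4) 1.
    pose g4 := upd g3 i (j + 1).
    have gbx x : x < t + 4 -> gb x = g x by move=> ltx; rewrite s3 ?gax.
    have gbi : gb i = j by rewrite gbx ?gi //; lia.
    have gbt1 : gb t.+1 = m by rewrite gbx ?gt1 //; lia.
    have g1t4 : g1 (t + 4) = v by rewrite /g1; updsimp.
    have g1t5 : g1 (t + 5) = v - m by rewrite /g1; updsimp.
    have g3i : g3 i = j by rewrite /g3 /g2 /g1; updsimp.
    have g3t4 : g3 (t + 4) = 1 by rewrite /g3; updsimp.
    have [|||g' r4 inv4] := IHk j.+1 g4.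
    + by lia.
    + by lia.
    + have nx x : x < t + 4 -> x <> i -> x <> y -> g4 x = g x.
        by move=> ltx nei ney; rewrite -gbx // /g4 /g3 /g2 /g1; updsimp.
      split; last split.
      * by move=> x ltx nei ney; rewrite nx ?gx //; lia.
      * by rewrite /g4; updsimp.
      * by rewrite /= /F -/F -/v /g4 /g3 /g2 minnE; updsimp.
      * by rewrite nx ?gt //; lia.
      * by rewrite nx ?gt1 //; lia.
      * by rewrite nx ?gt2 //; lia.
      * by rewrite nx ?gt3 //; lia.
    exists g' => //; apply: reaches_trans r4.
    apply: reaches_trans.
      by apply: (reaches_op (o := OSub) fM5); rewrite /= ?gt ?gi; lia.
    rewrite /= gt gi -/ga; apply: reaches_trans.
      have := @reaches_jumpz _ ga _ _ fM6.
      have -> : ga (t + 4) = k.+1 by rewrite /ga /upd eqxx.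
      by move=> rj; exact: rj.
    apply: reaches_trans r3 _; rewrite -/a3.
    apply: reaches_trans.
      by apply: (reaches_op (o := OSub) fM7); rewrite /= ?v3 ?gbt1; lia.
    rewrite /= v3 gbt1 -/g1; apply: reaches_trans.
      by apply: (reaches_op (o := OSub) fM8); rewrite /= ?g1t4 ?g1t5; lia.
    rewrite /= g1t4 g1t5 -/g2; apply: reaches_trans.
      by apply: (reaches_const fM9); lia.
    rewrite -/g3; apply: reaches_trans.
      by apply: (reaches_op (o := OAdd) fM10); rewrite /= ?g3i ?g3t4; lia.
    by rewrite /= g3i g3t4 -/g4; apply: reaches_jump fM11.
  have [g rg [gx gi gy gt [gt1 gt2 gt3]]] := loop N 0 f6 (esym (subn0 N)) (leq0n N)
    inv6.
  pose g1 := upd g t (g y); pose g2 := upd g1 i (g1 (t + 2)).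
  pose g3 := upd g2 y (g2 (t + 3)).
  have g1t2 : g1 (t + 2) = f i by rewrite /g1; updsimp.
  have g2t3 : g2 (t + 3) = f y by rewrite /g2 /g1; updsimp.
  exists g3; split.
  + apply: reaches_trans r1 _; apply: reaches_trans r2 _.
    apply: reaches_trans r6 _; apply: reaches_trans rg _.
    have -> : a + size (cexp a t n ++ c2 ++ [:: Move (t + 2) i, Move (t + 3) y,
        Const i 0, Move y t.+1, Defs.Sub (t + 4) t i, JumpZ (t + 4) a3.+4.+1
        & c3 ++ [:: Defs.Sub (t + 5) (t + 4) t.+1; Defs.Sub y (t + 4) (t + 5);
          Const (t + 4) 1; Add i i (t + 4); Jump a2.+4;
          Move t y; Move i (t + 2); Move y (t + 3)]]) = a3.+4.+4.
      by rewrite !size_cat /= size_cat /= /a3 /a2 /a1; lia.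
    apply: reaches_trans.
      by apply: (reaches_move fM12); [lia | rewrite gy; have := accm N; lia].
    rewrite -/g1; apply: reaches_trans; first by apply: (reaches_move fM13);
      [lia | rewrite g1t2].
    by rewrite -/g2; apply: (reaches_move fM14); [lia | rewrite g2t3].
  + move=> x ltx; have [->|/eqP ney] := eqVneq x y; first by rewrite /g3 {1}/upd eqxx.
    have [->|/eqP nei] := eqVneq x i; first by rewrite /g3 /g2; updsimp.
    by rewrite -gx // /g3 /g2 /g1; updsimp.
  + by rewrite /g3 /g2 /g1 -/(F _) -gy; updsimp.
Qed.

End Compile.

(** * While programs *)

Inductive com :=
| Skip
| Asgn of nat & expr
| Seq of com & com
| If of expr & com & com
| While of expr & com.

(** [B] bounds assigned values only; values met inside expressions are controlled by degrees. *)
Inductive ev (w : bitseq) (B : nat) : com -> memory -> memory -> Prop :=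
| EvSkip s : ev w B Skip s s
| EvAsgn x e s of eval w (get s) e <= B :
    ev w B (Asgn x e) s (put s x (eval w (get s) e))
| EvSeq c1 c2 s1 s2 s3 of ev w B c1 s1 s2 & ev w B c2 s2 s3 :
    ev w B (Seq c1 c2) s1 s3
| EvIfT e c1 c2 s s' of eval w (get s) e != 0 & ev w B c1 s s' :
    ev w B (If e c1 c2) s s'
| EvIfF e c1 c2 s s' of eval w (get s) e = 0 & ev w B c2 s s' :
    ev w B (If e c1 c2) s s'
| EvWhileF e c s of eval w (get s) e = 0 : ev w B (While e c) s s
| EvWhileT e c s1 s2 s3 of eval w (get s1) e != 0 & ev w B c s1 s2
    & ev w B (While e c) s2 s3 : ev w B (While e c) s1 s3.

Fixpoint wfc nv c : bool :=
  match c with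
  | Skip => true
  | Asgn x e => (x < nv) && wfe nv e
  | Seq c1 c2 => wfc nv c1 && wfc nv c2
  | If e c1 c2 => [&& wfe nv e, wfc nv c1 & wfc nv c2]
  | While e c => wfe nv e && wfc nv c
  end.

Fixpoint cdeg c : nat :=
  match c with
  | Skip => 1
  | Asgn _ e => deg e
  | Seq c1 c2 => cdeg c1 + cdeg c2
  | If e c1 c2 => deg e + cdeg c1 + cdeg c2
  | While e c => deg e + cdeg c
  end.

Fixpoint ctemps c : nat :=
  match c with
  | Skip => 0
  | Asgn _ e => temps e
  | Seq c1 c2 => ctemps c1 + ctemps c2
  | If e c1 c2 => temps e + ctemps c1 + ctemps c2
  | While e c => temps e + ctemps c
  end.

Lemma cdeg_gt0 c : 0 < cdeg c.
Proof. by elim: c => //= *; rewrite ?addn_gt0 ?deg_gt0 //; lia. Qed.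

(** * Compilation of while programs *)

Fixpoint ccom nv a (c : com) : program :=
  match c with
  | Skip => [::]
  | Asgn x e => cexp a nv e ++ [:: Move x nv]
  | Seq c1 c2 =>
      let p1 := ccom nv a c1 in p1 ++ ccom nv (a + size p1) c2
  | If e c1 c2 =>
      let p0 := cexp a nv e in
      let p1 := ccom nv (a + size p0).+1 c1 in
      let l2 := (a + size p0 + size p1).+2 in
      let p2 := ccom nv l2 c2 in
      p0 ++ JumpZ nv l2 :: p1 ++ Jump (l2 + size p2) :: p2
  | While e c =>
      let p0 := cexp a nv e in
      let p1 := ccom nv (a + size p0).+1 c in
      p0 ++ JumpZ nv (a + size p0 + size p1).+2 :: p1 ++ [:: Jump a]
  end.

(** Induction on the derivation rather than on the command, because a loop runs its own code again.
    All commands share the temporaries from [nv] on, so registers and state agree only below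
    [nv]. *)
Lemma ccom_reaches M w r V nv B c s s' a f : 1 < B ->
  ev w B c s s' -> wfc nv c -> code_at M a (ccom nv a c) ->
  nv + ctemps c <= r -> B ^ cdeg c <= V ->
  (forall x, get s x <= B) -> (forall x, x < nv -> f x = get s x) ->
  exists f', [/\ reaches M w r V a f (a + size (ccom nv a c)) f',
    forall x, x < nv -> f' x = get s' x & forall x, get s' x <= B].
Proof.
move=> B2 evc; have B0 : 0 < B by apply: ltnW.
have leBV e d : deg e <= d -> B ^ d <= V -> B ^ deg e <= V /\ B <= V.
  move=> led leV; have le_eV : B ^ deg e <= V.
    by apply: leq_trans leV; rewrite leq_exp2l.
  by split=> //; apply: leq_trans le_eV; apply: leq_expr; rewrite ?deg_gt0.
have cexpP e d : wfe nv e -> deg e <= d -> B ^ d <= V ->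
    forall s, (forall x, get s x <= B) ->
    forall a f, (forall x, x < nv -> f x = get s x) ->
    code_at M a (cexp a nv e) -> nv + temps e <= r ->
  exists f', [/\ reaches M w r V a f (a + size (cexp a nv e)) f',
    forall x, x < nv -> f' x = get s x & f' nv = eval w (get s) e].
  move=> we led leV s0 leB a0 f0 eqf cat ler.
  have [leeV leV'] := leBV _ _ led leV.
  have [x ltx|x ltx|f' [rf sf vf]] :=
    @cexp_reaches M w r V nv e B a0 nv f0 B2 we cat (leqnn nv) ler leeV.
  - by rewrite eqf.
  - by rewrite eqf //; apply: leq_trans (leB _) leV'.
  exists f'; split=> //; first by move=> x ltx; rewrite sf ?eqf.
  by rewrite vf; apply: eval_ext we _.
have dle d1 d2 : d1 <= d2 -> B ^ d2 <= V -> B ^ d1 <= V.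
  by move=> le12; apply: leq_trans; rewrite leq_exp2l.
elim: evc a f => {c s s'}.
- move=> s a f _ _ _ _ leB eqf; exists f; split=> //.
  by rewrite addn0; apply: reaches_refl.
- move=> x e s vB a f /= /andP[ltx we] /code_at_cat[cat /code_at_cons[fM _]] ler
  leV leB eqf.
  have [f' [rf sf vf]] := cexpP _ _ we (leqnn _) leV _ leB _ _ eqf cat ler.
  have [leeV leV'] := leBV _ _ (leqnn _) leV.
  exists (upd f' x (f' nv)); split.
  + apply: reaches_trans rf _; rewrite size_cat addnA addn1.
    by apply: (reaches_move _ fM); [lia | rewrite vf; lia].
  + by move=> y lty; rewrite get_put /upd vf sf.
  + by move=> y; rewrite get_put /upd; case: ifP.
- move=> c1 c2 s1 s2 s3 _ IH1 _ IH2 a f /= /andP[w1 w2] /code_at_cat[cat1 cat2] ler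
  leV leB eqf.
  have [||f1 [r1 eq1 le1]] := IH1 a f w1 cat1 _ _ leB eqf; first lia.
    by apply: dle leV; apply: leq_addr.
  have [||f2 [r2 eq2 le2]] := IH2 _ f1 w2 cat2 _ _ le1 eq1; first lia.
    by apply: dle leV; apply: leq_addl.
  by exists f2; split=> //; rewrite size_cat addnA; apply: reaches_trans r1 r2.
- move=> e c1 c2 s s' nz _ IH a f /= /and3P[we w1 w2].
  move=> /code_at_cat[cat0 /code_at_cons[fM1 /code_at_cat[cat1 /code_at_cons[fM2
    _]]]] ler leV leB eqf.
  have [||f0 [r0 s0 v0]] := cexpP _ _ we _ leV _ leB _ _ eqf cat0; try lia.
  have [||f1 [r1 eq1 le1]] := IH _ f0 w1 cat1 _ _ leB s0; first lia.
    by apply: dle leV; lia.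
  exists f1; split=> //; apply: reaches_trans r0 _.
  have := @reaches_jumpz _ w r V _ f0 _ _ fM1; rewrite v0 (negPf nz) => rj.
  apply: reaches_trans rj _; apply: reaches_trans r1 _.
  rewrite size_cat /= size_cat /=; move: fM2; rewrite addSn => fM2.
  have := @reaches_jump _ w r V _ f1 _ fM2; congr (reaches _ _ _ _ _ _ _ _); lia.
- move=> e c1 c2 s s' z _ IH a f /= /and3P[we w1 w2].
  move=> /code_at_cat[cat0 /code_at_cons[fM1 /code_at_cat[_ /code_at_cons[_
    cat2]]]] ler leV leB eqf.
  have [||f0 [r0 s0 v0]] := cexpP _ _ we _ leV _ leB _ _ eqf cat0; try lia.
  rewrite addSn in cat2.
  have [||f1 [r1 eq1 le1]] := IH _ f0 w2 cat2 _ _ leB s0; first lia.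
    by apply: dle leV; lia.
  exists f1; split=> //; apply: reaches_trans r0 _.
  have := @reaches_jumpz _ w r V _ f0 _ _ fM1; rewrite v0 z eqxx => rj.
  apply: reaches_trans rj _.
  rewrite size_cat /= size_cat /=.
  by move: r1; congr (reaches _ _ _ _ _ _ _ _); lia.
- move=> e c s z a f /= /andP[we wc].
  move=> /code_at_cat[cat0 /code_at_cons[fM1 _]] ler leV leB eqf.
  have [||f0 [r0 s0 v0]] := cexpP _ _ we _ leV _ leB _ _ eqf cat0; try lia.
  exists f0; split=> //; apply: reaches_trans r0 _.
  have := @reaches_jumpz _ w r V _ f0 _ _ fM1; rewrite v0 z eqxx.
  rewrite size_cat /= size_cat /=; congr (reaches _ _ _ _ _ _ _ _); lia.
- move=> e c s1 s2 s3 nz _ IH1 _ IH2 a f wf cat ler leV leB eqf.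
  move: (wf) (cat) (ler) (leV) => /= /andP[we wc].
  move=> /code_at_cat[cat0 /code_at_cons[fM1 /code_at_cat[cat1 /code_at_cons[fM2
    _]]]] ler' leV'.
  have [||f0 [r0 s0 v0]] := cexpP _ _ we _ leV' _ leB _ _ eqf cat0; try lia.
  have [||f1 [r1 eq1 le1]] := IH1 _ f0 wc cat1 _ _ leB s0; first lia.
    by apply: dle leV'; lia.
  have [f2 [r2 eq2 le2]] := IH2 _ f1 wf cat ler leV le1 eq1.
  exists f2; split=> //; apply: reaches_trans r0 _.
  have := @reaches_jumpz _ w r V _ f0 _ _ fM1; rewrite v0 (negPf nz) => rj.
  apply: reaches_trans rj _; apply: reaches_trans r1 _.
  by apply: reaches_trans r2; apply: reaches_jump.
Qed.

Lemma get_nil x : get [::] x = 0.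
Proof. exact: nth_nil. Qed.

Definition decider nv x (c : com) : program :=
  let p := ccom nv 0 c in
  p ++ [:: JumpZ x (size p).+2; Halt true; Halt false].

(** Assigned values up to [2 ^ L] give registers up to [2 ^ (L * cdeg c)], a bound of the same form
    with a constant factor in the exponent. *)
Lemma decider_computes nv x c : x < nv -> wfc nv c ->
  exists C, forall w L s, 0 < L -> ev w (2 ^ L) c [::] s ->
  exists t sp, [/\ computes (decider nv x c) w (get s x != 0) t sp,
    t <= 2 ^ (C * L) & sp <= C * L].
Proof.
move=> ltx wc; set M := decider nv x c; set r := nv + ctemps c.
have [C boundC] := within_computes M r.
exists (C * cdeg c) => w L s L0 evc.
have catM : code_at M 0 M by [].
have [cat1 /code_at_cons[fM1 /code_at_cons[fM2 /code_at_cons[fM3 _]]]] :=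
  code_at_cat catM.
have V0 : 0 < L * cdeg c by rewrite muln_gt0 L0 cdeg_gt0.
have [|||f [rf eqf _]] :=
  @ccom_reaches M w r (2 ^ (L * cdeg c)) nv (2 ^ L) c [::] s 0 (get [::]) _ evc wc
    cat1 (leqnn r) _ _ (fun _ _ => erefl).
- by rewrite -{1}(expn0 2) ltn_exp2l.
- by rewrite expnM.
- by move=> y; rewrite get_nil.
have win0 : within r (2 ^ (L * cdeg c)) [::] by split=> // y; rewrite get_nil.
have rj := reaches_trans rf (@reaches_jumpz M w _ _ _ f _ _ fM1).
have [R [lead win eqR]] := rj _ win0 (fun=> erefl).
have [|t [sp [comp let_ les]]] := boundC w _ (get s x != 0) _ V0 lead win.
  rewrite /= eqf // add0n; case: eqP => _; first by move: fM3; rewrite add0n => ->.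
  by move: fM2; rewrite add0n => ->.
by exists t, sp; rewrite -mulnA [cdeg c * L]mulnC.
Qed.

(** * Placements reachable by swaps *)

Section Words.
Variables (n : nat) (e : rel 'I_n).
Local Open Scope group_scope.

Definition word (s : seq ('I_n * 'I_n)) : {perm 'I_n} := foldl (@swap n) 1 s.

Definition valid (s : seq ('I_n * 'I_n)) := all (fun uv => e uv.1 uv.2) s.

Lemma foldl_swap p s : foldl (@swap n) p s = p * word s.
Proof.
rewrite /word; elim/last_ind: s => [|s uv IHs] /=; first by rewrite mulg1.
by rewrite !foldl_rcons IHs /swap mulgA.
Qed.

Lemma word_cat s1 s2 : word (s1 ++ s2) = word s1 * word s2.
Proof. by rewrite {1}/word foldl_cat foldl_swap. Qed.

Lemma word1 uv : word [:: uv] = tperm uv.1 uv.2.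
Proof. by rewrite /word /= /swap mul1g. Qed.

(** Conjugating [tperm x v] by the first swap [tperm u x] gives [tperm u v], so each further edge
    costs two more swaps. *)
Lemma tperm_word u p : path e u p ->
  exists s, [/\ valid s, size s <= (2 * size p)%N & word s = tperm u (last u p)].
Proof.
elim: p u => [|x p IHp] u /=; first by exists [::]; rewrite tperm1.
move=> /andP[eux /IHp [s [vs szs ws]]]; move: ws; set v := last x p => ws.
(* The conjugation formula requires [v] to differ from [u] and from [x]; these two cases are settled
   directly. *)
have [->|nvu] := eqVneq v u; first by exists [::]; rewrite tperm1.
have [->|nvx] := eqVneq v x.
  by exists [:: (u, x)]; rewrite word1 /= eux; split=> //; rewrite mulnS.
exists ((u, x) :: s ++ [:: (u, x)]); split.
- by rewrite /valid /= all_cat /= eux; move: vs; rewrite /valid => ->.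
- by rewrite /= size_cat /=; lia.
- rewrite -cat1s !word_cat word1 ws /=.
  have -> : tperm u x * (tperm x v * tperm u x) = tperm x v ^ tperm u x.
    by rewrite conjgE tpermV.
  by rewrite tpermJ tpermR tpermD // eq_sym.
Qed.

Lemma connect_tperm_word u v : connect e u v ->
  exists s, [/\ valid s, size s <= (2 * n)%N & word s = tperm u v].
Proof.
case/connectP=> p /shortenP[p' pp' uniqp' _ ->].
have [s [vs szs ws]] := tperm_word pp'; exists s; split=> //.
apply: leq_trans szs _; rewrite leq_mul2l /=.
have := max_card (mem (u :: p')); rewrite card_ord; move/card_uniqP: uniqp' => -> /=.
exact: ltnW.
Qed.

(** Composing with the transposition of [q t] and [t] makes [t] a fixed point and moves no new
    point, so induction on the number of moved points applies. *)
Lemma connect_perm_word (q : {perm 'I_n}) : (forall t, connect e t (q t)) ->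
  exists s, [/\ valid s, size s <= (2 * n * #|[set t | q t != t]|)%N & word s = q].
Proof.
have [m] := ubnP #|[set t | q t != t]|; elim: m q => // m IHm q ltm conq.
have [q1|[t]] := set_0Vmem [set t | q t != t].
  exists [::]; split=> //; apply/permP=> t; rewrite /word /= perm1.
  by have := in_set0 t; rewrite -q1 inE => /negbFE/eqP.
rewrite inE => nqt; pose q' := q * tperm (q t) t.
have q'E x : q' x = if x == t then t else if q x == t then q t else q x.
  rewrite permM; have [->|nxt] := eqVneq x t; first by rewrite tpermL.
  case: eqP => [->|/eqP nqx]; first by rewrite tpermR.
  by rewrite tpermD // ?(inj_eq perm_inj) eq_sym.
have proper_q' : [set x | q' x != x] \proper [set x | q x != x].
  apply/properP; split; last by exists t; rewrite !inE ?q'E ?eqxx.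
  apply/subsetP=> x; rewrite !inE q'E; case: (eqVneq x t) => [->|nxt];
    first by rewrite eqxx.
  by case: (eqVneq (q x) t) => [->|//] _; rewrite eq_sym.
have [||s [vs szs ws]] := IHm q'.
- by apply: leq_trans (proper_card proper_q') _.
- move=> x; rewrite q'E; case: (eqVneq x t) => [->|_]; first exact: connect0.
  by case: (eqVneq (q x) t) => [qx|_]; [apply: connect_trans (conq x) _; rewrite qx|].
have [s' [vs' szs' ws']] := connect_tperm_word (conq t).
exists (s ++ s'); split.
- by rewrite /valid all_cat; apply/andP.
- have := proper_card proper_q'; rewrite size_cat; nia.
- by rewrite word_cat ws ws' /q' [tperm t _]tpermC -mulgA tperm2 mulg1.
Qed.

Lemma word_connect s t : symmetric e -> valid s -> connect e t (word s t).
Proof.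
move=> syme; elim/last_ind: s => [|s [u v] IHs].
  by rewrite /word perm1 connect0.
rewrite /valid all_rcons => /andP[/= euv /IHs con].
rewrite -cats1 word_cat word1 permM /=; apply: connect_trans con _.
case: tpermP => [->|->|_ _]; [exact: connect1 | by rewrite connect1 // syme |].
exact: connect0.
Qed.

(** The only trace kept of [s] is that every token stays in its connected component. *)
Lemma short_word s : symmetric e -> valid s ->
  exists s', [/\ valid s', size s' <= (2 * n ^ 2)%N & word s' = word s].
Proof.
move=> syme vs; have [t|s' [vs' szs' ws']] := @connect_perm_word (word s).
  exact: word_connect.
exists s'; split=> //; apply: leq_trans szs' _.
rewrite expnS expn1 mulnA leq_mul2l.
by have := max_card (mem [set t | word s t != t]); rewrite card_ord => ->; rewrite orbT.
Qed.

End Words.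

Definition reachable_within (I : instance) K :=
  exists s : seq ('I_(nb_vertices I) * 'I_(nb_vertices I)),
    [/\ size s <= K, valid (edge (i := I)) s
      & forall t, word s t \in dest (i := I) t].

Lemma reachable_within_saturates I K1 K2 :
  2 * nb_vertices I ^ 2 <= K1 -> 2 * nb_vertices I ^ 2 <= K2 ->
  reachable_within I K1 <-> reachable_within I K2.
Proof.
have sat K K' : 2 * nb_vertices I ^ 2 <= K' ->
    reachable_within I K -> reachable_within I K'.
  move=> leK [s [_ vs ds]].
  have [s' [vs' szs' ws']] := short_word (edge_sym (i := I)) vs.
  by exists s'; split=> //; [apply: leq_trans szs' _ | rewrite ws'].
by move=> le1 le2; split; apply: sat.
Qed.

(** * Base-[n] numerals and codes of placements *)

Definition digit n x t := (x %/ n ^ t) %% n.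

Lemma digit_sum n m x : x < n ^ m -> x = \sum_(t < m) digit n x t * n ^ t.
Proof.
elim: m x => [|m IHm] x ltx.
  by rewrite big_ord0; move: ltx; rewrite expn0; case: x.
have n0 : 0 < n by case: n ltx {IHm} => //; rewrite exp0n.
rewrite big_ord_recl /= {1}/digit expn0 divn1 muln1 {1}(divn_eq x n) addnC.
congr (_ + _); rewrite {1}(IHm (x %/ n)); last by rewrite ltn_divLR // -expnSr.
rewrite big_distrl /=; apply: eq_bigr => t _.
by rewrite /bump /= add1n /digit -divnMA -expnS -mulnA -expnSr.
Qed.

Lemma sum_digits_lt n m (g : 'I_m -> nat) :
  (forall t, g t < n) -> \sum_(t < m) g t * n ^ t < n ^ m.
Proof.
elim: m g => [|m IHm] g ltg; first by rewrite big_ord0.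
rewrite big_ord_recr /= expnS.
have := IHm (fun t => g (widen_ord (leqnSn m) t)) (fun t => ltg _).
have := leq_mul (ltg ord_max) (leqnn (n ^ m)); rewrite mulSn => leN ltN.
by apply: leq_trans leN; rewrite ltn_add2r.
Qed.

Lemma digit_sum_digits n m (g : 'I_m -> nat) (t : 'I_m) :
  (forall t, g t < n) -> digit n (\sum_(i < m) g i * n ^ i) t = g t.
Proof.
elim: m g t => [|m IHm] g t ltg; first by case: t.
have n0 : 0 < n := leq_ltn_trans (leq0n _) (ltg ord0).
have -> : \sum_(i < m.+1) g i * n ^ i
    = (\sum_(i < m) g (lift ord0 i) * n ^ i) * n + g ord0.
  rewrite big_ord_recl /= muln1 addnC big_distrl /=; congr (_ + _).
  by apply: eq_bigr => i _; rewrite -mulnA -expnSr.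
case: (unliftP ord0 t) => [j|] ->; last first.
  by rewrite /digit /= divn1 modnMDl modn_small.
rewrite /digit /= /bump /= add1n expnS divnMA divnMDl // [g ord0 %/ n]divn_small //
  addn0.
exact: (IHm (fun i => g (lift ord0 i))).
Qed.

Definition code n (p : {perm 'I_n}) := \sum_(t < n) p t * n ^ t.

Lemma code_lt n (p : {perm 'I_n}) : code p < n ^ n.
Proof. by apply: sum_digits_lt => t; apply: ltn_ord. Qed.

Lemma digit_code n (p : {perm 'I_n}) (t : 'I_n) : digit n (code p) t = p t.
Proof. by apply: (digit_sum_digits (g := fun t => p t)) => i; apply: ltn_ord. Qed.

Lemma code_eq n (p : {perm 'I_n}) x : x < n ^ n ->
  (forall t : 'I_n, digit n x t = p t) -> x = code p.
Proof.
by move=> ltx eqx; rewrite (digit_sum ltx); apply: eq_bigr => t _; rewrite eqx.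
Qed.

(** * The configuration graph *)

Lemma query_cat w1 w2 i :
  query (w1 ++ w2) i = if i < size w1 then query w1 i else query w2 (i - size w1).
Proof. by rewrite /query map_cat nth_cat size_map. Qed.

Lemma query_catr w1 w2 i : query (w1 ++ w2) (size w1 + i) = query w2 i.
Proof. by rewrite query_cat ltnNge leq_addr addKn. Qed.

Lemma query_nth w i : i < size w -> query w i = nth false w i.
Proof. by move=> lti; rewrite /query (nth_map false). Qed.

Lemma nth_allpairs S T R (g : S -> T -> R) s t x0 a0 b0 i j :
  i < size s -> j < size t ->
  nth x0 [seq g x y | x <- s, y <- t] (i * size t + j) = g (nth a0 s i) (nth b0 t j).
Proof.
elim: s i => //= x s IHs [|i] lti ltj; rewrite nth_cat size_map.
  by rewrite mul0n add0n ltj (nth_map b0).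
by rewrite mulSn -addnA ltnNge leq_addr addKn IHs.
Qed.

Lemma query_matrix n (g : 'I_n -> 'I_n -> bool) w (u v : 'I_n) :
  query ([seq g x y | x <- enum 'I_n, y <- enum 'I_n] ++ w) (u * n + v) = g u v.
Proof.
have szI : size (enum 'I_n) = n by rewrite size_enum_ord.
have lti : u * n + v < size [seq g x y | x <- enum 'I_n, y <- enum 'I_n].
  by rewrite size_allpairs szI; have := ltn_ord u; have := ltn_ord v; nia.
rewrite query_cat lti query_nth //.
have -> : u * n + v = u * size (enum 'I_n) + v by rewrite szI.
by rewrite (nth_allpairs _ _ u v) ?szI // !nth_ord_enum.
Qed.

Section Encoding.
Variable I : instance.
Let n := nb_vertices I.
Let k := budget I.

Lemma query_unary i : i <= n -> query (encode I) i = (i < n).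
Proof.
rewrite /encode query_cat size_nseq -/n leq_eqVlt => /orP[/eqP->|lti].
  by rewrite ltnn subnn.
by rewrite lti query_nth ?size_nseq // nth_nseq lti.
Qed.

Lemma query_edge (u v : 'I_n) :
  query (encode I) (1 + n + (u * n + v)) = edge (i := I) u v.
Proof.
rewrite /encode catA.
have {1}-> : 1 + n = size (nseq (nb_vertices I) true ++ [:: false]).
  by rewrite size_cat size_nseq addnC.
by rewrite query_catr query_matrix.
Qed.

Lemma query_dest (t v : 'I_n) :
  query (encode I) (1 + n + n * n + (t * n + v)) = (v \in dest (i := I) t).
Proof.
rewrite /encode catA catA.
set w1 := (X in query (X ++ _)); have {1}-> : 1 + n + n * n = size w1.
  by rewrite !size_cat size_nseq size_allpairs size_enum_ord /= [1 + n]addnC.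
by rewrite query_catr query_matrix.
Qed.

(** The answer 2 marks the end of the budget, which has no other delimiter. *)
Lemma query_budget i :
  query (encode I) (1 + n + n * n + n * n + i) =
  if i < nbits k then nat_of_bool (odd (k %/ 2 ^ i)) else 2.
Proof.
rewrite /encode catA catA catA.
set w1 := (X in query (X ++ _)); have {1}-> : 1 + n + n * n + n * n = size w1.
  by rewrite !size_cat size_nseq !size_allpairs size_enum_ord /= [1 + n]addnC.
rewrite query_catr /binary -/k; case: ltnP => [lti|lei]; last first.
  by rewrite /query nth_default // !size_map size_iota.
by rewrite query_nth ?size_map ?size_iota // (nth_map 0) ?size_iota // nth_iota.
Qed.

End Encoding.

(* Adjacency of configurations as an expression *)
Declare Scope expr_scope.
Delimit Scope expr_scope with E.
Bind Scope expr_scope with expr.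
Notation "x + y" := (Bin OAdd x y) : expr_scope.
Notation "x - y" := (Bin OSub x y) : expr_scope.
Notation "x * y" := (Bin OMul x y) : expr_scope.
Notation "x / y" := (Bin ODiv x y) : expr_scope.

(* Variables of the decision program: [V_n] is the number of vertices and
   [V_B = n ^ n]; numbers below [V_B] code maps from tokens to vertices by their
   base-[n] digits, and [V_B] itself is the accepting node. The last three
   variables are local to expressions. *)
Notation V_n := 0 (only parsing).
Notation V_B := 1 (only parsing).
Notation V_p := 2 (only parsing).
Notation V_q := 3 (only parsing).
Notation V_l := 4 (only parsing).
Notation V_m := 5 (only parsing).
Notation V_f := 6 (only parsing).
Notation V_r := 7 (only parsing).
Notation V_c := 8 (only parsing).
Notation V_S := 9 (only parsing).
Notation V_W := 10 (only parsing).
Notation V_i := 11 (only parsing).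
Notation V_j := 12 (only parsing).
Notation V_d := 13 (only parsing).
Notation V_a := 14 (only parsing).

Definition mod_e (x y : expr) : expr := x - x / y * y.
(** With truncated subtraction, the sum of the two differences is 0 exactly when the values are
    equal. *)
Definition eq_e (x y : expr) : expr := Cst 1 - ((x - y) + (y - x)).
Definition not_e (x : expr) : expr := Cst 1 - x.
(** A product capped at its initial value 1, so any nonzero value of [x] counts as true. *)
Definition all_e i (m x : expr) : expr := Iter i V_a m (Cst 1) (Var V_a * x).
Definition digit_e (x t : expr) : expr :=
  mod_e (Iter V_d V_a t x (Var V_a / Var V_n)) (Var V_n).
Definition tperm_e (u v x : expr) : expr :=
  eq_e x u * v + not_e (eq_e x u) * (eq_e x v * u + not_e (eq_e x v) * x).

Definition dest_e : expr :=
  all_e V_j (Var V_n)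
    (Query (Cst 1 + Var V_n + Var V_n * Var V_n
            + (Var V_j * Var V_n + digit_e (Var V_p) (Var V_j)))).

(** An ordered pair of vertices is the number [u * n + v]; the existential quantifier over pairs is
    a negated universal one. *)
Definition swap_e : expr :=
  not_e (all_e V_i (Var V_n * Var V_n)
    (not_e (Query (Cst 1 + Var V_n + Var V_i)
      * all_e V_j (Var V_n)
          (eq_e (digit_e (Var V_q) (Var V_j))
             (tperm_e (Var V_i / Var V_n) (mod_e (Var V_i) (Var V_n))
                (digit_e (Var V_p) (Var V_j))))))).

(** Sums and products act as disjunction and conjunction, truncated subtraction as the test [q < B],
    and the double negation reduces the result to 0 or 1. *)
Definition adj_e : expr :=
  not_e (not_e (eq_e (Var V_p) (Var V_q)
    + eq_e (Var V_q) (Var V_B) * dest_e + (Var V_B - Var V_q) * swap_e)).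

Definition tperm_nat (u v x : nat) := if x == u then v else if x == v then u else x.

Definition dest_ok w n p :=
  all (fun t => 0 < query w (1 + n + n * n + (t * n + digit n p t))) (iota 0 n).

Definition swap_ok w n p q :=
  has (fun e => (0 < query w (1 + n + e)) &&
    all (fun t => digit n q t == tperm_nat (e %/ n) (e %% n) (digit n p t))
      (iota 0 n)) (iota 0 (n * n)).

(* Stay, accept, or swap. *)
Definition adj w n B p q :=
  [|| p == q, (q == B) && dest_ok w n p | (q < B) && swap_ok w n p q].

Section EvalExpr.
Variables (w : bitseq) (f : nat -> nat).

Lemma eval_mod x y : eval w f (mod_e x y) = eval w f x %% eval w f y.
Proof. by rewrite /= {1}(divn_eq (eval w f x) (eval w f y)) addKn. Qed.

Lemma eval_eq x y : eval w f (eq_e x y) = (eval w f x == eval w f y).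
Proof. by rewrite /=; case: eqP; lia. Qed.

Lemma eval_not x : eval w f (not_e x) = (eval w f x == 0).
Proof. by rewrite /=; case: eqP; lia. Qed.

(** Quantifying the hypothesis over every accumulator value [y] expresses that the truth of [x] does
    not depend on [V_a]. *)
Lemma eval_all i m x (P : pred nat) :
  (forall j y, (0 < eval w (upd (upd f i j) V_a y) x) = P j) ->
  eval w f (all_e i m x) = all P (iota 0 (eval w f m)).
Proof.
move=> eqP /=; elim: (eval w f m) => [//|d IHd].
have -> : iota 0 d.+1 = iota 0 d ++ [:: d] by rewrite -addn1 iotaD.
rewrite all_cat /= andbT IHd -(eqP d (all P (iota 0 d))).
case: (all P _); rewrite /upd /= ?mul0n ?min0n // mul1n minnC.
by case: (eval w _ x) => [|[|v]].
Qed.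

Lemma eval_digit x t :
  eval w f (digit_e x t) = digit (f V_n) (eval w f x) (eval w f t).
Proof.
rewrite /digit_e eval_mod /digit; congr (_ %% _) => /=.
elim: (eval w f t) => [|d IHd] /=; first by rewrite divn1.
(* Quotients never exceed the initial value, so the cap does not take effect. *)
by rewrite /upd /= IHd expnSr divnMA (minn_idPl _) // -divnMA leq_div.
Qed.

Lemma eval_tperm u v x :
  eval w f (tperm_e u v x) = tperm_nat (eval w f u) (eval w f v) (eval w f x).
Proof.
have -> : eval w f (tperm_e u v x) = eval w f (eq_e x u) * eval w f v
    + eval w f (not_e (eq_e x u)) * (eval w f (eq_e x v) * eval w f u
      + eval w f (not_e (eq_e x v)) * eval w f x) by [].
rewrite !(eval_not (eq_e _ _)) !eval_eq /tperm_nat; case: eqP => _ /=;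
  first by rewrite mul1n addn0.
by case: eqP => _ /=; rewrite !mul1n ?addn0.
Qed.

End EvalExpr.

Section EvalAdj.
Variables (w : bitseq) (f : nat -> nat).

Lemma eval_dest : eval w f dest_e = dest_ok w (f V_n) (f V_p).
Proof.
apply: eval_all => j y; set g := upd _ _ _.
rewrite -[eval w g _]/(query w (1 + g V_n + g V_n * g V_n
  + (g V_j * g V_n + eval w g (digit_e (Var V_p) (Var V_j))))).
by rewrite eval_digit.
Qed.

Lemma eval_swap : eval w f swap_e = swap_ok w (f V_n) (f V_p) (f V_q).
Proof.
rewrite /swap_e eval_not.
rewrite (@eval_all _ _ _ _ _ (fun e => ~~ ((0 < query w (1 + f V_n + e)) &&
    all (fun t => digit (f V_n) (f V_q) t
      == tperm_nat (e %/ f V_n) (e %% f V_n) (digit (f V_n) (f V_p) t))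
    (iota 0 (f V_n))))).
  by rewrite eqb0 /swap_ok -has_predC; congr (nat_of_bool _); apply: eq_has => e /=;
    rewrite negbK.
move=> e y; set g := upd _ _ _; rewrite eval_not lt0b; set ex := all_e _ _ _.
rewrite -[eval w g _]/(query w (1 + g V_n + g V_i) * eval w g ex).
rewrite (@eval_all _ _ _ _ _ (fun t => digit (f V_n) (f V_q) t
    == tperm_nat (e %/ f V_n) (e %% f V_n) (digit (f V_n) (f V_p) t))).
  by rewrite muln_eq0 eqb0 negb_and -eqn0Ngt.
move=> t z; set h := upd _ _ _.
rewrite eval_eq eval_tperm !eval_digit eval_mod lt0b.
by [].
Qed.

Lemma eval_adj : eval w f adj_e = adj w (f V_n) (f V_B) (f V_p) (f V_q).
Proof.
rewrite /adj_e; set x := (X in not_e (not_e X));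
  rewrite eval_not [eval _ _ (not_e x)]eval_not.
have -> : eval w f x = eval w f (eq_e (Var V_p) (Var V_q))
    + eval w f (eq_e (Var V_q) (Var V_B)) * eval w f dest_e
    + (f V_B - f V_q) * eval w f swap_e by [].
rewrite !eval_eq eval_dest eval_swap /= eqb0 -lt0n !addn_gt0 !muln_gt0 !lt0b subn_gt0.
by rewrite /adj orbA.
Qed.

End EvalAdj.

(** * Walks and placements *)

Section Walks.
Variables (B : nat) (e : rel nat).

(** Nodes are confined to numbers up to [B], so that midpoints can be found by exhaustive search. *)
Fixpoint walk l p q : Prop :=
  if l is l'.+1 then exists m, [/\ m <= B, e p m & walk l' m q] else p = q.

Lemma walk1 p q : q <= B -> walk 1 p q <-> e p q.
Proof.
move=> leq; split=> [[m [_ epm <-]] // | epq]; by exists q.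
Qed.

Lemma walk_add a b p q : p <= B ->
  walk (a + b) p q <-> exists m, [/\ m <= B, walk a p m & walk b m q].
Proof.
elim: a p => [|a IHa] p lep /=.
  by split=> [wpq | [m [_ -> //]]]; exists p.
split=> [[m [lem epm /(IHa _ lem)[m' [lem' w1 w2]]]] | [m' [lem' [m [lem epm w1]] w2]]].
  by exists m'; split=> //; exists m.
by exists m; split=> //; apply/(IHa _ lem); exists m'.
Qed.

End Walks.

Section Placements.
Variable I : instance.
Let n := nb_vertices I.
Let B := n ^ n.
Let eI := adj (encode I) n B.
Local Notation edgeI := (edge (i := I)).

Lemma tperm_nat_val (u v x : 'I_n) : tperm_nat u v x = tperm u v x.
Proof.
rewrite /tperm_nat !(inj_eq val_inj); case: tpermP => [->|->|/eqP/negPf->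
  /eqP/negPf->] //.
  by rewrite eqxx.
by rewrite eqxx; case: eqP => [->|].
Qed.

Lemma dest_okP (p : {perm 'I_n}) :
  reflect (forall t, p t \in dest (i := I) t) (dest_ok (encode I) n (code p)).
Proof.
apply: (iffP allP) => [okp t | okp t].
  have := okp t; rewrite mem_iota ltn_ord => /(_ isT).
  by rewrite digit_code query_dest lt0b.
rewrite mem_iota /= => ltt; have := @query_dest I (Ordinal ltt) (p (Ordinal ltt)).
by rewrite okp -digit_code /= => ->.
Qed.

(** [y] is not assumed to code a placement: the swapped pair forces its [n] digits, and these
    determine it. So a swap step from a placement leads to a placement again. *)
Lemma swap_okP (p : {perm 'I_n}) y : y < B ->
  reflect (exists2 uv, edgeI uv.1 uv.2 & y = code (swap p uv))
    (swap_ok (encode I) n (code p) y).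
Proof.
move=> lty; apply: (iffP hasP) => [[e] | [[u v] /= euv ->]].
  rewrite mem_iota /= => lte /andP[q_e /allP okt].
  have n0 : 0 < n by case: (n) lte.
  have ltu : e %/ n < n by rewrite ltn_divLR.
  have ltv : e %% n < n by rewrite ltn_mod.
  exists (Ordinal ltu, Ordinal ltv) => /=.
    by move: q_e; rewrite {1}(divn_eq e n) (query_edge (Ordinal ltu) (Ordinal ltv))
      lt0b.
  apply: code_eq => // t; have := okt t; rewrite mem_iota ltn_ord => /(_ isT)/eqP->.
  by rewrite digit_code (tperm_nat_val (Ordinal ltu) (Ordinal ltv)) /swap permM.
have n0 : 0 < n := leq_ltn_trans (leq0n u) (ltn_ord u).
exists (u * n + v).
  by rewrite mem_iota /=; have := ltn_ord u; have := ltn_ord v; nia.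
rewrite query_edge euv /=; apply/allP => t; rewrite mem_iota /= => ltt.
rewrite divnMDl // divn_small // addn0 modnMDl modn_small //.
have := digit_code (swap p (u, v)) (Ordinal ltt); rewrite /= => ->.
by have := digit_code p (Ordinal ltt); rewrite /= => ->;
  rewrite tperm_nat_val /swap permM.
Qed.

Lemma adj_code_sink (p : {perm 'I_n}) :
  reflect (forall t, p t \in dest (i := I) t) (eI (code p) B).
Proof.
rewrite /eI /adj ltnn eqxx (ltn_eqF (code_lt p)) /= orbF; exact: dest_okP.
Qed.

Lemma adj_code (p : {perm 'I_n}) y : y < B ->
  reflect (y = code p \/ exists2 uv, edgeI uv.1 uv.2 & y = code (swap p uv))
    (eI (code p) y).
Proof.
move=> lty; rewrite /eI /adj lty (ltn_eqF lty) /= eq_sym.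
by apply: (iffP orP) => -[/eqP|/(swap_okP _ lty)]; [left|right|left|right].
Qed.

(** Staying in place pads short swap sequences, and one step is reserved for entering [B], hence the
    strict bound on the size. At the first entry into [B] the current placement satisfies [dest],
    whatever the rest of the walk does. *)
Lemma walk_code l (p : {perm 'I_n}) :
  walk B eI l (code p) B <->
  exists s, [/\ size s < l, valid edgeI s
    & forall t, (p * word s)%g t \in dest (i := I) t].
Proof.
elim: l p => [|l IHl] p.
  split=> [/= eqB | [s []//]]; by have := code_lt p; rewrite eqB ltnn.
split=> /=.
  move=> [m [lem adjm wm]]; move: lem; rewrite leq_eqVlt => /orP[/eqP eqm|ltm].
    move: adjm; rewrite eqm => /adj_code_sink okp.
    by exists [::]; split=> // t; rewrite /word /= mulg1.
  case/(adj_code _ ltm): adjm => [eqm | [uv euv eqm]]; move: wm; rewrite eqm.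
    by move/IHl => [s [szs vs ds]]; exists s; split=> //; apply: ltnW.
  move/IHl => [s [szs vs ds]]; exists (uv :: s); split=> //.
    by rewrite /valid /= euv.
  by move=> t; rewrite -cat1s word_cat word1 mulgA; apply: ds.
move=> [[|uv s] [szs vs ds]].
  exists B; split=> //.
    by apply/adj_code_sink => t; have := ds t; rewrite /word /= mulg1.
  (* The remaining steps are spent waiting at [B]. *)
  elim: (l) => //= l' w; exists B; split=> //.
  by rewrite /eI /adj eqxx.
move: vs; rewrite /valid /= => /andP[euv vs].
exists (code (swap p uv)); split; first exact: ltnW (code_lt _).
  by apply/adj_code; [exact: code_lt | right; exists uv].
apply/IHl; exists s; split=> // t.
by have := ds t; rewrite -cat1s word_cat word1 mulgA.
Qed.

Lemma walk_reachable K :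
  walk B eI K.+1 (\sum_(t < n) t * n ^ t) B <-> reachable_within I K.
Proof.
have -> : \sum_(t < n) t * n ^ t = code (1%g : {perm 'I_n}).
  by apply: eq_bigr => t _; rewrite perm1.
split=> [/walk_code [s [szs vs ds]] | [s [szs vs ds]]].
  by exists s; split=> // t; have := ds t; rewrite mul1g.
by apply/walk_code; exists s; split=> // t; rewrite mul1g.
Qed.

End Placements.

(** * Savitch's recursion *)

Notation "c1 ;; c2" := (Seq c1 c2) (at level 90, right associativity).
Notation "x ::= e" := (Asgn x e%E) (at level 85).

(* A frame [(p, q, l, m, f)] is the search for a walk of length [l] from [p] to
   [q] with midpoint [m]; [f = 1] once the left half has been found. The control
   [V_c] is 1 to call the search for [(p, q, l)], and 0 to return the answer
   [V_r] to the frame on top of the stack [V_S], which has base [V_W]. *)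
Definition push_frame : com :=
  V_S ::= ((((Var V_S * Var V_W + Var V_p) * Var V_W + Var V_q) * Var V_W
            + Var V_l) * Var V_W + Var V_m) * Var V_W + Var V_f.

Definition pop x : com :=
  x ::= mod_e (Var V_S) (Var V_W) ;; V_S ::= Var V_S / Var V_W.

Definition pop_frame : com := pop V_f ;; pop V_m ;; pop V_l ;; pop V_q ;; pop V_p.

Definition savitch_body : com :=
  If (Var V_c)
    (If (Var V_l - Cst 1)
       (V_m ::= Cst 0 ;; V_f ::= Cst 0 ;; push_frame ;;
        V_q ::= Cst 0 ;; V_l ::= Var V_l / Cst 2)
       (V_r ::= adj_e ;; V_c ::= Cst 0))
    (pop_frame ;;
     If (Var V_r)
       (If (Var V_f) Skip
          (V_f ::= Cst 1 ;; push_frame ;; V_p ::= Var V_m ;;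
           V_l ::= Var V_l - Var V_l / Cst 2 ;; V_c ::= Cst 1))
       (If (Var V_B - Var V_m)
          (V_m ::= Var V_m + Cst 1 ;; V_f ::= Cst 0 ;; push_frame ;;
           V_q ::= Var V_m ;; V_l ::= Var V_l / Cst 2 ;; V_c ::= Cst 1)
          Skip)).

Definition savitch : com := While (Var V_c + Var V_S) savitch_body.

(** Entries follow the numbering of the variables; the final zeros belong to the three variables
    local to expressions. *)
Definition st n B p q l m f r c S W i : memory :=
  [:: n; B; p; q; l; m; f; r; c; S; W; i; 0; 0; 0].

Lemma ev_asgn w D x e s v s' :
  eval w (get s) e = v -> v <= D -> put s x v = s' -> ev w D (Asgn x e) s s'.
Proof. by move=> <- lev <-; apply: EvAsgn. Qed.

Lemma ev_ifT w D e c1 c2 s s' :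
  0 < eval w (get s) e -> ev w D c1 s s' -> ev w D (If e c1 c2) s s'.
Proof. by move=> e0; apply: EvIfT; rewrite -lt0n. Qed.

Ltac asgn := eapply ev_asgn; [reflexivity | cbn | reflexivity].
Ltac seq_asgn := eapply EvSeq; [asgn | ].

Section Savitch.
Variables (w : bitseq) (D n B W i : nat).
Hypothesis (W2 : 1 < W) (ltBW : B < W).

Definition push S p q l m f := ((((S * W + p) * W + q) * W + l) * W + m) * W + f.

Lemma ev_push_frame p q l m f r c S : push S p q l m f <= D ->
  ev w D push_frame (st n B p q l m f r c S W i)
    (st n B p q l m f r c (push S p q l m f) W i).
Proof. by move=> leD; asgn. Qed.

Lemma ev_pop x s s1 s2 S v : get s V_W = W -> get s V_S = S * W + v ->
  v < W -> S * W + v <= D -> put s x v = s1 ->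
  get s1 V_W = W -> get s1 V_S = S * W + v -> put s1 V_S S = s2 ->
  ev w D (pop x) s s2.
Proof.
move=> sW sS ltv leD e1 s1W s1S e2; apply: (EvSeq (s2 := s1)).
  apply: (ev_asgn (v := v)) e1; last by lia.
  by rewrite eval_mod; change (get s V_S %% get s V_W = v);
    rewrite sW sS modnMDl modn_small.
apply: (ev_asgn (v := S)) e2; last by nia.
by change (get s1 V_S %/ get s1 V_W = S);
  rewrite s1W s1S divnMDl ?divn_small ?addn0 //; lia.
Qed.

Lemma ev_pop_frame p q l m f p' q' l' m' f' r c S :
  p < W -> q < W -> l < W -> m < W -> f < W -> push S p q l m f <= D ->
  ev w D pop_frame (st n B p' q' l' m' f' r c (push S p q l m f) W i)
    (st n B p q l m f r c S W i).
Proof.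
rewrite /push => ltp ltq ltl ltm ltf leD.
set S1 := S * W + p in leD *; set S2 := S1 * W + q in leD *.
set S3 := S2 * W + l in leD *; set S4 := S3 * W + m in leD *.
have le4 : S4 <= D by nia.
have le3 : S3 <= D by nia.
have le2 : S2 <= D by nia.
have le1 : S1 <= D by nia.
eapply EvSeq; first by apply: (@ev_pop V_f _ _ _ S4 f).
eapply EvSeq; first by apply: (@ev_pop V_m _ _ _ S3 m).
eapply EvSeq; first by apply: (@ev_pop V_l _ _ _ S2 l).
eapply EvSeq; first by apply: (@ev_pop V_q _ _ _ S1 q).
by apply: (@ev_pop V_p _ _ _ S p).
Qed.

(* [s'] is reached from [s] by iterations of the loop, in continuation form. *)
Definition loops s s' := forall s'', ev w D savitch s' s'' -> ev w D savitch s s''.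

Lemma loops_body s s' : 0 < get s V_c + get s V_S -> ev w D savitch_body s s' ->
  loops s s'.
Proof. by move=> cs evb s'' evs; apply: EvWhileT evb evs; rewrite -lt0n. Qed.

Lemma loops_trans s1 s2 s3 : loops s1 s2 -> loops s2 s3 -> loops s1 s3.
Proof. by move=> l12 l23 s /l23/l12. Qed.

Lemma body_leaf p q m f r S : 0 < D ->
  ev w D savitch_body (st n B p q 1 m f r 1 S W i)
    (st n B p q 1 m f (adj w n B p q) 0 S W i).
Proof.
move=> D0; apply: ev_ifT => //; apply: EvIfF => //.
apply: (EvSeq (s2 := st n B p q 1 m f (adj w n B p q) 1 S W i)); last by asgn.
apply: ev_asgn; [exact: eval_adj | exact: leq_trans (leq_b1 _) D0 | by []].
Qed.

Lemma body_enter p q l m f r S : 1 < l -> l <= D -> push S p q l 0 0 <= D ->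
  ev w D savitch_body (st n B p q l m f r 1 S W i)
    (st n B p 0 (l %/ 2) 0 0 r 1 (push S p q l 0 0) W i).
Proof.
move=> l2 leD lepD; apply: ev_ifT => //; apply: ev_ifT; first by rewrite /= subn_gt0.
seq_asgn => //; seq_asgn => //.
eapply EvSeq; first by apply: ev_push_frame.
seq_asgn => //; asgn; exact: leq_trans (leq_div _ _) leD.
Qed.

Lemma body_right p q l m p' q' l' m' f' r S :
  p < W -> q < W -> l < W -> m < W -> W <= D -> push S p q l m 1 <= D -> 0 < r ->
  ev w D savitch_body (st n B p' q' l' m' f' r 0 (push S p q l m 0) W i)
    (st n B m q (l - l %/ 2) m 1 r 1 (push S p q l m 1) W i).
Proof.
move=> ltp ltq ltl ltm leW lepD r0; apply: EvIfF => //.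
eapply EvSeq.
  by apply: ev_pop_frame => //; [lia | move: lepD; rewrite /push; lia].
apply: ev_ifT => //; apply: EvIfF => //.
seq_asgn; first by lia.
eapply EvSeq; first by apply: ev_push_frame.
seq_asgn; first by lia.
seq_asgn; first by lia.
by asgn; lia.
Qed.

Lemma body_return p q l m p' q' l' m' f' r S :
  p < W -> q < W -> l < W -> m < W -> push S p q l m 1 <= D -> 0 < r ->
  ev w D savitch_body (st n B p' q' l' m' f' r 0 (push S p q l m 1) W i)
    (st n B p q l m 1 r 0 S W i).
Proof.
move=> ltp ltq ltl ltm lepD r0; apply: EvIfF => //.
eapply EvSeq; first by apply: ev_pop_frame.
by apply: ev_ifT => //; apply: ev_ifT => //; apply: EvSkip.
Qed.

Lemma body_next p q l m f p' q' l' m' f' S : m < B ->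
  p < W -> q < W -> l < W -> f < W -> W <= D -> push S p q l m f <= D ->
  push S p q l m.+1 0 <= D ->
  ev w D savitch_body (st n B p' q' l' m' f' 0 0 (push S p q l m f) W i)
    (st n B p m.+1 (l %/ 2) m.+1 0 0 1 (push S p q l m.+1 0) W i).
Proof.
move=> ltm ltp ltq ltl ltf leW lepD lepD'; apply: EvIfF => //.
eapply EvSeq; first by apply: ev_pop_frame => //; lia.
apply: EvIfF => //; apply: ev_ifT; first by rewrite /= subn_gt0.
eapply EvSeq.
  by apply: (ev_asgn (v := m.+1)); [exact: addn1 | lia | reflexivity].
seq_asgn; first by lia.
eapply EvSeq; first by apply: ev_push_frame.
seq_asgn; first by lia.
seq_asgn; first by lia.
by asgn; lia.
Qed.

Lemma body_fail p q l f p' q' l' m' f' S :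
  p < W -> q < W -> l < W -> f < W -> push S p q l B f <= D ->
  ev w D savitch_body (st n B p' q' l' m' f' 0 0 (push S p q l B f) W i)
    (st n B p q l B f 0 0 S W i).
Proof.
move=> ltp ltq ltl ltf lepD; apply: EvIfF => //.
eapply EvSeq; first by apply: ev_pop_frame => //; lia.
by apply: EvIfF => //; apply: EvIfF; [rewrite /= subnn | apply: EvSkip].
Qed.

(** The successors make the estimate multiplicative: each frame costs a factor [W ^ 5]. *)
Lemma push_lt S p q l m f : p < W -> q < W -> l < W -> m < W -> f < W ->
  (push S p q l m f).+1 <= S.+1 * W ^ 5.
Proof.
rewrite /push => ltp ltq ltl ltm ltf.
have step x y : y < W -> (x * W + y).+1 <= x.+1 * W by nia.
rewrite !expnS expn0 muln1 !mulnA.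
by do !apply: leq_trans (step _ _ _) (leq_mul _ (leqnn W)) => //.
Qed.

(** A positive length in the frame keeps a nonempty stack different from 0, so the loop guard
    detects it. *)
Lemma push_gt0 S p q l m f : 0 < l -> 0 < push S p q l m f.
Proof. by rewrite /push => l0; nia. Qed.

(** Induction on the depth [h]. A call becomes a return with the same stack [S], whatever [S]
    contains, so nested calls can be chained; the bound on [D] leaves room for [h] more frames. *)
Lemma savitch_correct h l p q S m f r :
  0 < l -> l <= 2 ^ h -> l < W -> p <= B -> q <= B -> S.+1 * W ^ (5 * h) <= D ->
  exists p' q' l' m' f' r',
    loops (st n B p q l m f r 1 S W i) (st n B p' q' l' m' f' r' 0 S W i) /\
    (0 < r' <-> walk B (adj w n B) l p q).
Proof.
elim: h l p q S m f r => [|h IHh] l p q S m f r l0 lel ltl lep leq leD.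
  have -> : l = 1 by move: lel; rewrite expn0; lia.
  exists p, q, 1, m, f, (adj w n B p q); split.
    by apply: loops_body => //; apply: body_leaf; move: leD; rewrite muln0 expn0; lia.
  by rewrite lt0b walk1.
have [l1|l2] : l = 1 \/ 1 < l by lia.
  rewrite l1; exists p, q, 1, m, f, (adj w n B p q); split.
    apply: loops_body => //; apply: body_leaf; apply: leq_trans leD.
    by rewrite muln_gt0 expn_gt0; lia.
  by rewrite lt0b walk1.
have leD' : S.+1 * W ^ 5 * W ^ (5 * h) <= D by rewrite -mulnA -expnD -mulnS.
have Wh0 : 0 < W ^ (5 * h) by rewrite expn_gt0; lia.
have leD5 : S.+1 * W ^ 5 <= D by apply: leq_trans leD'; rewrite leq_pmulr.
have W5 : W <= W ^ 5 by rewrite -{1}(expn1 W) leq_exp2l.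
have leW : W <= D by nia.
have pushP m' f' : m' <= B -> f' < 2 ->
    push S p q l m' f' <= D /\ (push S p q l m' f').+1 * W ^ (5 * h) <= D.
  move=> lem ltf'; have := @push_lt S p q l m' f'.
  move=> /(_ (leq_ltn_trans lep ltBW) (leq_ltn_trans leq ltBW) ltl
             (leq_ltn_trans lem ltBW) (leq_trans ltf' W2)) lepush.
  split; first by apply: ltnW; apply: leq_trans lepush leD5.
  by apply: leq_trans leD'; rewrite leq_mul2r lepush orbT.
have half0 : 0 < l %/ 2 by rewrite divn_gt0.
have lehalf : l %/ 2 <= 2 ^ h by move: lel; rewrite expnS; lia.
have lehalf' : l - l %/ 2 <= 2 ^ h by move: lel; rewrite expnS; lia.
have walk_l : walk B (adj w n B) l p q <-> exists m, [/\ m <= B,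
    walk B (adj w n B) (l %/ 2) p m & walk B (adj w n B) (l - l %/ 2) m q].
  by rewrite -walk_add // subnKC // leq_div.
pose good m := walk B (adj w n B) (l %/ 2) p m /\ walk B (adj w n B) (l - l %/ 2) m q.
(* The search over the midpoints from [m0] on, by induction on how many are left. *)
have search k m0 r0 : B - m0 < k -> m0 <= B ->
    exists p' q' l' m' f' r',
    loops (st n B p m0 (l %/ 2) m0 0 r0 1 (push S p q l m0 0) W i)
      (st n B p' q' l' m' f' r' 0 S W i) /\
    (0 < r' <-> exists m, m0 <= m <= B /\ good m).
  elim: k m0 r0 => // k IHk m0 r0 ltk lem0.
  (* A failure returns from the left half if [f0 = 0] and from the right half if [f0 = 1]: the frame
     passes to the next midpoint, or fails in turn when [m0 = B]. *)
  have next p1 q1 l1 m1 f1 f0 : f0 < 2 -> exists p' q' l' m' f' r',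
      loops (st n B p1 q1 l1 m1 f1 0 0 (push S p q l m0 f0) W i)
        (st n B p' q' l' m' f' r' 0 S W i) /\
      (0 < r' <-> exists m, m0 < m <= B /\ good m).
    move=> ltf0; have [lep0 _] := pushP m0 f0 lem0 ltf0.
    have nonempty s : 0 < s + push S p q l m0 f0 by rewrite addn_gt0 push_gt0 ?orbT.
    case: (ltngtP m0 B) lem0 => // [ltm0 _|eqm0 _].
      have [lep1 _] := pushP m0.+1 0 ltm0 isT.
      have [|p' [q' [l' [m' [f' [r' [lo eqr]]]]]]] := IHk m0.+1 0 _ ltm0; first by lia.
      exists p', q', l', m', f', r'; split=> //; apply: loops_trans lo.
      by apply: loops_body; [exact: nonempty | apply: body_next => //; lia].
    exists p, q, l, B, f0, 0; split.
      apply: loops_body; first exact: nonempty.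
      by rewrite eqm0; apply: body_fail; rewrite -?eqm0 //; lia.
    by split=> // -[m3 [/andP[ltm lem] _]]; move: ltm; rewrite eqm0 ltnNge lem.
  have skip r' : ~ good m0 -> (0 < r' <-> exists m, m0 < m <= B /\ good m) ->
      (0 < r' <-> exists m, m0 <= m <= B /\ good m).
    move=> bad ->; split=> -[m3 [/andP[ltm lem] gm]]; exists m3; split=> //.
      by rewrite ltnW.
    rewrite lem andbT; case: (ltngtP m0 m3) ltm => // eqm _.
    by case: bad; rewrite eqm.
  have [lep0 leD0] := pushP m0 0 lem0 isT.
  have [p1 [q1 [l1 [m1 [f1 [r1 [lo1 eqr1]]]]]]] :=
    IHh (l %/ 2) p m0 (push S p q l m0 0) m0 0 r0 half0 lehalf
      (leq_ltn_trans (leq_div _ _) ltl) lep lem0 leD0.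
  have [r1_0|r1_gt0] := posnP r1.
    have [p' [q' [l' [m' [f' [r' [lo eqr]]]]]]] := next p1 q1 l1 m1 f1 0 isT.
    exists p', q', l', m', f', r'; split.
      by apply: loops_trans lo1 _; rewrite r1_0.
    by apply: skip eqr => -[/eqr1]; rewrite r1_0.
  have [lep1 leD1] := pushP m0 1 lem0 isT.
  have [p2 [q2 [l2' [m2 [f2 [r2 [lo2 eqr2]]]]]]] :=
    IHh (l - l %/ 2) m0 q (push S p q l m0 1) m0 1 r1 (ltac:(lia)) lehalf'
      (leq_ltn_trans (leq_subr _ _) ltl) lem0 leq leD1.
  have lo12 : loops (st n B p m0 (l %/ 2) m0 0 r0 1 (push S p q l m0 0) W i)
      (st n B p2 q2 l2' m2 f2 r2 0 (push S p q l m0 1) W i).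
    apply: loops_trans lo1 _; apply: loops_trans lo2; apply: loops_body.
      exact: push_gt0.
    by apply: body_right => //; lia.
  have [r2_0|r2_gt0] := posnP r2.
    have [p' [q' [l' [m' [f' [r' [lo eqr]]]]]]] := next p2 q2 l2' m2 f2 1 isT.
    exists p', q', l', m', f', r'; split.
      by apply: loops_trans lo12 _; rewrite r2_0.
    by apply: skip eqr => -[_ /eqr2]; rewrite r2_0.
  exists p, q, l, m0, 1, r2; split.
    apply: loops_trans lo12 _; apply: loops_body; first exact: push_gt0.
    by apply: body_return => //; lia.
  split=> // _; exists m0; rewrite leqnn lem0; split=> //.
  by split; [apply/eqr1 | apply/eqr2].
have [le0 _] := pushP 0 0 (leq0n _) isT.
have [p' [q' [l' [m' [f' [r' [lo eqr]]]]]]] := search B.+1 0 r (leq_subr _ _) (leq0n _).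
exists p', q', l', m', f', r'; split.
  by apply: loops_trans lo; apply: loops_body => //; apply: body_enter => //; lia.
rewrite eqr walk_l; by split=> [[m3 [lem [w1 w2]]]|[m3 [lem w1 w2]]]; exists m3.
Qed.

End Savitch.

(** * The decision program *)

Definition count_vertices : com :=
  While (Query (Var V_n)) (V_n ::= Var V_n + Cst 1).

(** [V_B] runs through the powers of [n], supplying the place values for the code of the identity
    and ending at [n ^ n]. *)
Definition init_placement : com :=
  V_B ::= Cst 1 ;;
  While (Var V_n - Var V_i)
    (V_p ::= Var V_p + Var V_i * Var V_B ;; V_B ::= Var V_B * Var V_n ;;
     V_i ::= Var V_i + Cst 1).

(* At least twice the bound [2 n ^ 2] on useful swaps, so that rounding the budget
   to a power of two is harmless. *)
Definition cap_e : expr := Cst 4 * (Var V_n * Var V_n) + Cst 4.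

(** After [j] bits, [V_W] is [2 ^ j] and [V_l] is the budget modulo [2 ^ j]. The guard vanishes past
    the last bit, where the answer is 2, or once [V_W] reaches the cap, which then replaces the
    budget. *)
Definition read_budget : com :=
  V_W ::= Cst 1 ;;
  V_i ::= Cst 1 + Var V_n + Var V_n * Var V_n + Var V_n * Var V_n ;;
  While ((Cst 2 - Query (Var V_i)) * (cap_e - Var V_W))
    (V_l ::= Var V_l + Query (Var V_i) * Var V_W ;; V_W ::= Var V_W * Cst 2 ;;
     V_i ::= Var V_i + Cst 1) ;;
  If (cap_e - Var V_W) Skip (V_l ::= cap_e).

(* The first assignment only makes the memory long enough for [st]. *)
Definition decide_reachable : com :=
  V_a ::= Cst 0 ;; count_vertices ;; init_placement ;; read_budget ;;
  V_l ::= Var V_l + Cst 1 ;; V_q ::= Var V_B ;;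
  V_W ::= Var V_B + Var V_l + Cst 1 ;; V_c ::= Cst 1 ;; savitch.

Lemma modn_pow2S k j :
  k %% 2 ^ j.+1 = k %% 2 ^ j + odd (k %/ 2 ^ j) * 2 ^ j.
Proof.
set a := k %/ 2 ^ j; set b := k %% 2 ^ j.
have ltb : b < 2 ^ j by rewrite ltn_mod expn_gt0.
have -> : k = a./2 * 2 ^ j.+1 + (b + odd a * 2 ^ j).
  rewrite {1}(divn_eq k (2 ^ j)) -/a -/b -{1}(odd_double_half a) expnS.
  by rewrite -muln2; lia.
by rewrite modnMDl modn_small // expnS; case: (odd a); lia.
Qed.

Section Run.
Variable I : instance.
Let n := nb_vertices I.
Let k := budget I.
Let w := encode I.
Let cap := 4 * (n * n) + 4.
Let base := 1 + n + n * n + n * n.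
(** Large enough for every value assigned outside the stack, and for the base of the stack. *)
Definition value_bound := n ^ n + 10 * (n * n) + 20.

Lemma ev_count_vertices D j : n <= D -> j <= n ->
  ev w D count_vertices (st j 0 0 0 0 0 0 0 0 0 0 0) (st n 0 0 0 0 0 0 0 0 0 0 0).
Proof.
move=> leD; move eqm : (n - j) => m; elim: m j eqm => [|m IHm] j eqm lej.
  have -> : j = n by lia.
  by apply: EvWhileF; rewrite /= /get /= query_unary // ltnn.
have ltj : j < n by lia.
apply: (EvWhileT (s2 := st j.+1 0 0 0 0 0 0 0 0 0 0 0)).
- by rewrite /= /get /= query_unary // ltj.
- by apply: (ev_asgn (v := j.+1)); [exact: addn1 | lia | reflexivity].
- by apply: IHm; lia.
Qed.

Lemma ev_init_placement D : n <= D -> n ^ n <= D ->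
  ev w D init_placement (st n 0 0 0 0 0 0 0 0 0 0 0)
    (st n (n ^ n) (\sum_(t < n) t * n ^ t) 0 0 0 0 0 0 0 0 n).
Proof.
move=> leD leD'.
have loop m j : n - j = m -> j <= n ->
  ev w D (While (Var V_n - Var V_i)
    (V_p ::= Var V_p + Var V_i * Var V_B ;; V_B ::= Var V_B * Var V_n ;;
     V_i ::= Var V_i + Cst 1))
    (st n (n ^ j) (\sum_(t < j) t * n ^ t) 0 0 0 0 0 0 0 0 j)
    (st n (n ^ n) (\sum_(t < n) t * n ^ t) 0 0 0 0 0 0 0 0 n).
  elim: m j => [|m IHm] j eqm lej.
    have -> : j = n by lia.
    by apply: EvWhileF; rewrite /= /get /= subnn.
  have ltj : j < n by lia.
  have n0 : 0 < n by lia.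
  apply: (EvWhileT (s2 := st n (n ^ j.+1) (\sum_(t < j.+1) t * n ^ t) 0 0 0 0 0 0 0
    0 j.+1)).
  - by rewrite /= /get /= -lt0n subn_gt0.
  - apply: EvSeq.
      apply: (ev_asgn (v := \sum_(t < j.+1) t * n ^ t)); last reflexivity.
        by rewrite big_ord_recr.
      apply: leq_trans leD'; apply: ltnW; apply: leq_trans (_ : n ^ j.+1 <= _).
        by apply: sum_digits_lt => t; apply: leq_trans (ltn_ord t) ltj.
      by rewrite leq_pexp2l.
    apply: EvSeq.
      apply: (ev_asgn (v := n ^ j.+1)); [by rewrite expnSr | | reflexivity].
      by apply: leq_trans leD'; rewrite leq_pexp2l.
    by apply: (ev_asgn (v := j.+1)); [exact: addn1 | lia | reflexivity].
  - by apply: IHm; lia.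
apply: EvSeq; first by apply: (ev_asgn (v := n ^ 0)); [| apply: leq_trans leD';
  rewrite expn_gt0; case: (n) |].
have := loop _ 0 erefl (leq0n _); rewrite big_ord0; exact.
Qed.

(** [K <= 2 * k] serves the bound in terms of [k], and [K <= cap] the one in terms of [n]. If [K]
    differs from [k], both lie in the range where the budget no longer matters. *)
Lemma ev_read_budget D B p i : value_bound <= D ->
  exists K i', [/\ ev w D read_budget (st n B p 0 0 0 0 0 0 0 0 i)
                    (st n B p 0 K 0 0 0 0 0 (2 ^ (i' - base)) i'),
    K <= cap, K <= 2 * k & K = k \/ 2 * n ^ 2 <= K /\ 2 * n ^ 2 <= k].
Proof.
rewrite /value_bound => leD.
have nn : n <= n * n by case: (n) => // n'; rewrite leq_pmulr.
have loop m j : nbits k - j = m -> j <= nbits k -> (0 < j -> 2 ^ j.-1 < cap) ->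
  exists j', [/\ ev w D (While ((Cst 2 - Query (Var V_i)) * (cap_e - Var V_W))
    (V_l ::= Var V_l + Query (Var V_i) * Var V_W ;; V_W ::= Var V_W * Cst 2 ;;
     V_i ::= Var V_i + Cst 1))
    (st n B p 0 (k %% 2 ^ j) 0 0 0 0 0 (2 ^ j) (base + j))
    (st n B p 0 (k %% 2 ^ j') 0 0 0 0 0 (2 ^ j') (base + j')),
    j' <= nbits k & cap <= 2 ^ j' \/ j' = nbits k].
  elim: m j => [|m IHm] j eqm lej ltcap.
    have eqj : j = nbits k by lia.
    exists j; split=> //; last by right.
    apply: EvWhileF; rewrite /= /get /= query_budget -/k -/n eqj ltnn //.
  have ltj : j < nbits k by lia.
  have [lecap|ltcap'] := leqP cap (2 ^ j).
    exists j; split=> //; last by left.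
    apply: EvWhileF; change ((2 - query w (base + j)) * (cap - 2 ^ j) = 0).
    by rewrite (eqP lecap) muln0.
  have [|||j' [evl lej' fin]] := IHm j.+1; [lia | lia | by [] |].
  exists j'; split=> //; apply: EvWhileT evl.
    change ((2 - query w (base + j)) * (cap - 2 ^ j) != 0).
    rewrite query_budget -/k ltj -lt0n muln_gt0 !subn_gt0 ltcap' andbT.
    by case: (odd _).
  have jj : j < cap by apply: ltn_trans (ltn_expl j _) ltcap'.
  apply: EvSeq.
    apply: (ev_asgn (v := k %% 2 ^ j.+1)); last reflexivity.
      change (k %% 2 ^ j + query w (base + j) * 2 ^ j = k %% 2 ^ j.+1).
      by rewrite query_budget -/k ltj modn_pow2S.
    have : k %% 2 ^ j.+1 < 2 ^ j.+1 by rewrite ltn_mod expn_gt0.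
    by move: ltcap'; rewrite expnS /cap; lia.
  apply: EvSeq.
    apply: (ev_asgn (v := 2 ^ j.+1)); [by rewrite expnSr | | reflexivity].
    by move: ltcap'; rewrite expnS /cap; lia.
  apply: (ev_asgn (v := base + j.+1)); [by rewrite addnS; exact: addn1 | | reflexivity].
  by move: jj; rewrite /base /cap; lia.
have [//|j [evl lej fin]] := loop _ 0 erefl (leq0n _).
have start : ev w D read_budget (st n B p 0 0 0 0 0 0 0 0 i)
    (st n B p 0 (if cap <= 2 ^ j then cap else k) 0 0 0 0 0 (2 ^ j) (base + j)).
  apply: EvSeq; first by apply: (ev_asgn (v := 1)); [| lia |].
  apply: EvSeq.
    apply: (ev_asgn (v := base)); [by []| by rewrite /base; lia | reflexivity].
  apply: EvSeq; first by move: evl; rewrite expn0 modn1 addn0; exact.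
  case: leqP fin => [lecap _ | ltcap [//|eqj]].
    apply: EvIfF; first by change (cap - 2 ^ j = 0); apply/eqP.
    by apply: (ev_asgn (v := cap)); [| rewrite /cap; lia |].
  apply: ev_ifT; first by change (0 < cap - 2 ^ j); rewrite subn_gt0.
  have -> : k %% 2 ^ j = k by rewrite modn_small // eqj ltn_nbits.
  exact: EvSkip.
(* At most [nbits k] bits are read, and [2 ^ nbits k <= 2 * k] for positive [k]; for [k = 0] the
   additive 4 keeps the cap out of reach. *)
have cap2k : cap <= 2 ^ j -> cap <= 2 * k.
  have : 2 ^ j <= 2 ^ nbits k by rewrite leq_exp2l.
  rewrite /nbits expnS; have [->|k0] := posnP k; first by rewrite trunc_log0 /cap; lia.
  by have := @trunc_logP 2 k isT k0; lia.
exists (if cap <= 2 ^ j then cap else k), (base + j); rewrite addKn; split=> //.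
- by case: (leqP cap) fin => // ltcap [|eqj]; have := ltn_nbits k; rewrite -?eqj; lia.
- by case: (leqP cap) => [/cap2k|_]; lia.
- case: (leqP cap) => [/cap2k|_]; last by left.
  by rewrite /cap expnS expn1 => lek; right; lia.
Qed.

Lemma ev_mono D D' c s s' : D <= D' -> ev w D c s s' -> ev w D' c s s'.
Proof.
move=> leD; elim=> {c s s'}.
- by move=> s; apply: EvSkip.
- by move=> x e s les; apply: EvAsgn; apply: leq_trans les leD.
- by move=> c1 c2 s1 s2 s3 _ ev1 _ ev2; apply: EvSeq ev1 ev2.
- by move=> e c1 c2 s s' nz _ ev1; apply: EvIfT.
- by move=> e c1 c2 s s' z _ ev1; apply: EvIfF.
- by move=> e c s z; apply: EvWhileF.
- by move=> e c s1 s2 s3 nz _ ev1 _ ev2; apply: EvWhileT ev1 ev2.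
Qed.

(** Depth [nbits K] suffices for walks of length [K.+1], as [K < 2 ^ nbits K]; each level takes five
    digits in a base [W <= value_bound], whence the exponent. *)
Lemma ev_decide_reachable : exists K, [/\ K <= cap, K <= 2 * k &
  forall D, value_bound ^ (5 * nbits K).+1 <= D ->
  exists2 s, ev w D decide_reachable [::] s & (get s V_r != 0) <-> solvable_instance I].
Proof.
have Bpos : 0 < n ^ n by rewrite expn_gt0; case: (n).
set P := \sum_(t < n) t * n ^ t; set X := value_bound.
have X0 : 0 < X by rewrite /X /value_bound; lia.
have [K [i [evb leKcap leK eqK]]] := ev_read_budget (n ^ n) P n (leqnn X).
exists K; split=> // D leD; set W := n ^ n + K.+1 + 1.
have nn : n <= n * n by case: (n) => // n'; rewrite leq_pmulr.
have leXD : X <= D.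
  by apply: leq_trans leD; rewrite expnS leq_pmulr // expn_gt0 X0.
have leWX : W <= X by rewrite /W /X /value_bound; move: leKcap; rewrite /cap; lia.
have nD : n <= D by apply: leq_trans leXD; rewrite /X /value_bound; lia.
have BD : n ^ n <= D by apply: leq_trans leXD; rewrite /X /value_bound; lia.
have PB : P <= n ^ n by apply: ltnW; apply: sum_digits_lt => t; apply: ltn_ord.
have [||||p' [q' [l' [m' [f' [r' [lo eqr]]]]]]] :=
  @savitch_correct w D n (n ^ n) W i _ _ (nbits K) K.+1 P (n ^ n) 0 0 0 0 isT
     (ltn_nbits K) _ PB (leqnn _) _; try by rewrite /W; lia.
  rewrite mul1n; apply: leq_trans leD; apply: leq_trans (_ : X ^ (5 * nbits K) <= _).
    by rewrite leq_exp2r // /nbits mulnS.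
  by rewrite leq_pexp2l.
exists (st n (n ^ n) p' q' l' m' f' r' 0 0 W i); last first.
  rewrite -lt0n eqr walk_reachable.
  by case: eqK => [-> //|[leK1 leK2]]; apply: reachable_within_saturates.
have DK : K.+1 <= D by apply: leq_trans leXD; apply: leq_trans leWX; rewrite /W; lia.
apply: EvSeq; first by apply: (ev_asgn (v := 0)).
apply: EvSeq; first exact: (ev_count_vertices nD (leq0n n)).
apply: EvSeq; first exact: ev_init_placement.
apply: EvSeq; first exact: ev_mono leXD evb.
apply: EvSeq; first by apply: (ev_asgn (v := K.+1)); [exact: addn1 | | reflexivity].
apply: EvSeq; first by apply: (ev_asgn (v := n ^ n)).
apply: EvSeq.
  by apply: (ev_asgn (v := W)); [| apply: leq_trans leXD | reflexivity].
apply: EvSeq; first by apply: (ev_asgn (v := 1));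
  [| apply: leq_trans leXD | reflexivity].
by apply: lo; apply: EvWhileF.
Qed.

End Run.

(** * Logarithmic estimates and conclusion *)

Lemma nbits_value_bound I : let n := nb_vertices I in
  2 <= n -> nbits (value_bound I) <= 10 * (n * lg n).
Proof.
move=> n n2; have lg0 : 0 < lg n by rewrite trunc_log_gt0.
have nn : n * n <= n ^ n by rewrite mulnn leq_pexp2l //; lia.
have ltn : n < 2 ^ (lg n).+1 by apply: trunc_log_ltn.
have leX : value_bound I <= 2 ^ ((lg n).+1 * n + 4).
  apply: (@leq_trans (n ^ n * 2 ^ 4)).
    rewrite /value_bound -/n (_ : 2 ^ 4 = 16) //.
    by move: (n ^ n) (n * n) nn (leq_mul n2 n2) => x y; lia.
  rewrite expnD expnM; apply: leq_mul => //.
  by rewrite leq_exp2r; [exact: ltnW | exact: ltnW n2].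
apply: leq_trans (leq_nbits leX) _; rewrite nbits_exp2.
by move: (lg n) lg0 {ltn leX nn} => y y0; nia.
Qed.

Theorem theorem4 :
  exists (M : program) (c : nat), forall I : instance,
  let n := nb_vertices I in
  let k := budget I in
  exists (b : bool) (t s : nat),
    [/\ computes M (encode I) b t s,
        b <-> solvable_instance I,
        2 <= n -> 2 <= k ->
          t <= 2 ^ (c * (n * lg n * lg k)) /\ s <= c * (n * lg n * lg k)
      & 2 <= n ->
          t <= 2 ^ (c * (n * lg n ^ 2)) /\ s <= c * (n * lg n ^ 2)].
Proof.
have [C compP] := @decider_computes 15 V_r decide_reachable isT isT.
(* There are 15 program variables. The constant is [10 * 41]: 10 comes from [nbits X], and 41 covers
   [5 * nbits K + 1] in both bounds, the larger being [10 * lg n + 31]. *)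
exists (decider 15 V_r decide_reachable), (C * 410) => I n k.
have [K [leKcap leK evP]] := ev_decide_reachable I.
set X := value_bound I in evP; set L := nbits X * (5 * nbits K).+1.
have [|s0 ev0 eqb] := evP (2 ^ L).
  by rewrite /L expnM leq_exp2r // ltnW // ltn_nbits.
have [//|t [s [comp let_ les]]] := compP (encode I) L s0 _ ev0.
have bound A : L <= 410 * A -> t <= 2 ^ (C * 410 * A) /\ s <= C * 410 * A.
  rewrite -mulnA => leL; split; last by apply: leq_trans les _;
    rewrite leq_mul2l leL orbT.
  by apply: leq_trans let_ _; rewrite leq_exp2l // leq_mul2l leL orbT.
exists (get s0 V_r != 0), t, s; split; [exact: comp | exact: eqb | move=> n2 k2 |
  move=> n2]; apply: bound.
  have leX := nbits_value_bound n2.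
  have lg0 : 0 < lg k by rewrite trunc_log_gt0.
  have ltK : K <= 2 ^ (lg k).+2.
    by apply: leq_trans leK _; rewrite expnS leq_mul2l ltnW ?trunc_log_ltn.
  have := leq_nbits ltK; rewrite nbits_exp2 => leK3.
  apply: (@leq_trans (10 * (n * lg n) * (41 * lg k))).
    by apply: leq_mul leX _; move: (nbits K) (lg k) lg0 leK3 => x y; lia.
  by rewrite mulnACA.
have leX := nbits_value_bound n2.
have lg0 : 0 < lg n by rewrite trunc_log_gt0.
(* [4 <= n * n] gives [cap <= 8 * (n * n)]. *)
have ltK : K <= 2 ^ ((lg n).+1 * 2 + 3).
  have : n * n <= 2 ^ ((lg n).+1 * 2).
    by rewrite expnM -mulnn; apply: leq_mul; rewrite ltnW // trunc_log_ltn.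
  have : 2 * 2 <= n * n by apply: leq_mul.
  rewrite expnD (_ : 2 ^ 3 = 8) //; move: leKcap; rewrite -/n.
  by move: (n * n) (2 ^ (_ * 2)) => x y; lia.
have := leq_nbits ltK; rewrite nbits_exp2 => leK8.
apply: (@leq_trans (10 * (n * lg n) * (41 * lg n))).
  by apply: leq_mul leX _; move: (nbits K) (lg n) lg0 leK8 => x y; lia.
by rewrite mulnACA -mulnn [n * (_ * _)]mulnA.
Qed.
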